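(* Let $n \geq 3$, and for $i\in\{1,2,3\}$ let $A_i$ be a real symmetric $n\times n$ matrix, $b_i\in\mathbb{R}^n$ and $c_i\in\mathbb{R}$. Let \[ T = \left\{ x \in \mathbb{R}^n : \begin{bmatrix} x \\ 1 \end{bmatrix}^{\top} \begin{bmatrix} A_i & b_i \\ b_i^{\top} & c_i \end{bmatrix} \begin{bmatrix} x \\ 1 \end{bmatrix} \leq 0,\ i \in \{1,2,3\} \right\}. \] Assume: (1) there exists $\theta\in\mathbb{R}^3$ such that $\sum_{i=1}^3 \theta_i \begin{bmatrix} A_i & b_i \\ b_i^{\top} & c_i \end{bmatrix} \succ 0$; (2) $\mathrm{conv}(T)\neq\mathbb{R}^n$; (3) $T\subseteq \overline{\mathrm{int}(T)}$. For $\lambda\in\mathbb{R}^3_+$ let \[ T_\lambda = \left\{ x\in\mathbb{R}^n : \begin{bmatrix} x \\ 1 \end{bmatrix}^{\top} \left(\sum_{i=1}^3 \lambda_i \begin{bmatrix} A_i & b_i \\ b_i^{\top} & c_i \end{bmatrix}\right) \begin{bmatrix} x \\ 1 \end{bmatrix} \leq 0 \right\}, \] let $\nu(T_\lambda)$ be the number of negative eigenvalues of $\sum_{i=1}^3\lambda_i A_i$, and let \[ \Omega' = \{\lambda\in\mathbb{R}^3_+ : T_\lambda \supseteq \mathrm{conv}(T) \text{ and } \nu(T_\lambda)\leq 1\}. \] Then \[ \overline{\mathrm{conv}}(T) = \bigcap_{\lambda\in\Omega'} T_\lambda. \]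
   Context: $\mathbb{R}^3_+$ is the set of vectors in $\mathbb{R}^3$ with all entries nonnegative. For a symmetric matrix $M$, $M\succ 0$ means $M$ is positive definite. $\mathrm{conv}$ denotes the convex hull, $\overline{\mathrm{conv}}$ the closure of the convex hull, $\mathrm{int}$ the interior, and $\overline{X}$ the closure of a set $X$. Eigenvalues are counted with multiplicity.
   Formalization: The formal theorem additionally assumes that T is nonempty; for T empty the claim can fail, e.g. n = 4, x = (s,w), with quadratics |w|^2, -|s|^2, 1 + 2 s·w, where 0 lies in every T_λ with λ in Ω' although conv(T) is empty. *)

(* Defs.v *)
From HB Require Import structures.
From mathcomp Require Import all_boot all_order all_algebra.
From mathcomp Require Import polyrcf.
From mathcomp Require Import all_classical all_reals all_analysis.

Set Implicit Arguments.
Unset Strict Implicit.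
Unset Printing Implicit Defensive.

Import Order.TTheory GRing.Theory Num.Theory.
Import numFieldNormedType.Exports.

Local Open Scope classical_set_scope.
Local Open Scope ring_scope.

Definition convex_hull (R : numDomainType) (V : lmodType R) (X : set V) : set V :=
  smallest (@convex_set R V) X.

Definition posdefmx (R : numDomainType) (m : nat) (M : 'M[R]_m) : Prop :=
  forall v : 'cV[R]_m, v != 0 -> 0 < (v^T *m M *m v) 0 0.

(* [rootsR] lists each real root once, so multiplicities are restored by [mup];
   for symmetric M every eigenvalue is real. *)
Definition num_neg_eigenvalues (R : rcfType) (m : nat) (M : 'M[R]_m) : nat :=
  \sum_(x <- rootsR (char_poly M) | x < 0) mup x (char_poly M).

Definition quadmx (R : pzRingType) (n : nat)
    (A : 'M[R]_n) (b : 'cV[R]_n) (c : R) : 'M[R]_(n + 1) :=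
  block_mx A b b^T c%:M.

Definition homog (R : pzRingType) (n : nat) (x : 'cV[R]_n) : 'cV[R]_(n + 1) :=
  col_mx x 1%:M.

Definition quad_le0 (R : realType) (n : nat) (M : 'M[R]_(n + 1)) :
    set 'cV[R]_n :=
  [set x | ((homog x)^T *m M *m homog x) 0 0 <= 0].

Section aggregation.
Context (R : realType) (n : nat).
Variables (A : 'I_3 -> 'M[R]_n) (b : 'I_3 -> 'cV[R]_n) (c : 'I_3 -> R).

Definition quad_set : set 'cV[R]_n :=
  [set x | forall i, quad_le0 (quadmx (A i) (b i) (c i)) x].

Definition aggmx (lambda : 'cV[R]_3) : 'M[R]_(n + 1) :=
  \sum_(i < 3) lambda i 0 *: quadmx (A i) (b i) (c i).

Definition agg_set (lambda : 'cV[R]_3) : set 'cV[R]_n :=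
  quad_le0 (aggmx lambda).

(* This depends on lambda, and not only on the set [agg_set lambda]. *)
Definition agg_nu (lambda : 'cV[R]_3) : nat :=
  num_neg_eigenvalues (\sum_(i < 3) lambda i 0 *: A i).

Definition good_agg : set 'cV[R]_3 :=
  [set lambda : 'cV[R]_3 | [/\ forall i, 0 <= lambda i 0,
    convex_hull quad_set `<=` agg_set lambda & (agg_nu lambda <= 1)%N]].

End aggregation.

(* Main.v *)
Require Import Defs.
From HB Require Import structures.
From mathcomp Require Import all_boot all_order all_algebra.
From mathcomp Require Import ring lra.
From mathcomp Require Import polyrcf spectral complex.
From mathcomp Require Import all_classical all_reals all_analysis.

Set Implicit Arguments.
Unset Strict Implicit.
Unset Printing Implicit Defensive.

Import Order.TTheory GRing.Theory Num.Theory.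
Import numFieldNormedType.Exports.

Local Open Scope classical_set_scope.
Local Open Scope ring_scope.

(** One inclusion holds because every aggregated set is closed and the good ones
    contain the convex hull. For the other one, take [y] outside the closed convex
    hull of the feasible set [T] and look for good weights [l] whose aggregated
    quadratic is positive at [y].

    Separate [y] from the hull: [dot al x <= be < dot al y] for [x] in [T].
    Homogenise, and call slice the linear hyperplane of R^(n+1) spanned by a level
    set of [dot al]. On a slice whose level exceeds [be] the three quadratic forms
    are never all negative ([slice_some_ge0]). A slice has dimension at least 3
    and some combination of the forms is definite, so the joint values of the
    three forms on it make up a convex cone ([joint_range_convex]). A plane
    separating this cone from the negative octant gives nonnegative weights whose
    aggregated form is nonnegative on the slice ([slice_alternative]). Such
    weights are good: a form nonnegative on a hyperplane has at most one negative
    eigenvalue ([num_neg_eigenvalues_le1]), and the part of its nonpositive cone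
    lying on one side of that hyperplane is convex ([nappe_convex]).

    Convexity of the joint range rests on a path argument: on a plane conic
    [F = 0] passing through [u] and [v], another form of opposite signs at [u]
    and [v] must vanish somewhere ([common_zero]).

    The slice through [y] only gives an aggregated value [>= 0] at [y]; the strict
    inequality takes more ([strict_multiplier]). If no nonzero direction [z] of
    the level sets of [dot al] makes all three forms nonpositive, then on the slice
    the forms are bounded away from the negative octant, by compactness, and the
    weights can be taken strict ([alternative_strict]). Otherwise, since the pencil
    contains a definite form, some form is negative at [z]; as [z] belongs to
    every slice at once, that form gets weight 0 on all of them. At most two
    weights remain. Suppose that the aggregated value at [y] is nonpositive for
    all the slices near [y], and restrict the quadratics to the line joining [y]
    to an interior point of [T]. With a single weight left this is absurd; with
    two, both quadratics vanish at [y] ([weighted_quadratics_vanish]), and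
    definiteness makes the third one negative there, which puts [y] in [T]
    ([strict_multiplier_degenerate]). *)

(** * Bilinear forms *)
Definition bil (R : pzRingType) m (M : 'M[R]_m) (u v : 'cV[R]_m) : R :=
  (u^T *m M *m v) 0 0.

Section Bilinear.
Context (R : comPzRingType) (m : nat).
Implicit Types (M N : 'M[R]_m) (u v w : 'cV[R]_m).

Lemma bilDl M u v w : bil M (u + v) w = bil M u w + bil M v w.
Proof. by rewrite /bil linearD /= !mulmxDl mxE. Qed.
Lemma bilDr M u v w : bil M w (u + v) = bil M w u + bil M w v.
Proof. by rewrite /bil !mulmxDr mxE. Qed.
Lemma bilZl M a u w : bil M (a *: u) w = a * bil M u w.
Proof. by rewrite /bil linearZ /= -!scalemxAl mxE. Qed.
Lemma bilZr M a u w : bil M w (a *: u) = a * bil M w u.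
Proof. by rewrite /bil -!scalemxAr mxE. Qed.
Lemma bil0l M w : bil M 0 w = 0.
Proof. by rewrite -[0 in LHS](scale0r (0 : 'cV_m)) bilZl mul0r. Qed.
Lemma bil0r M w : bil M w 0 = 0.
Proof. by rewrite -[0 in LHS](scale0r (0 : 'cV_m)) bilZr mul0r. Qed.
Lemma bilNl M u w : bil M (- u) w = - bil M u w.
Proof. by rewrite -scaleN1r bilZl mulN1r. Qed.
Lemma bilNr M u w : bil M w (- u) = - bil M w u.
Proof. by rewrite -scaleN1r bilZr mulN1r. Qed.
Lemma bilC M u v : M^T = M -> bil M u v = bil M v u.
Proof.
move=> Msym; transitivity ((u^T *m M *m v)^T 0 0); first by rewrite mxE.
by rewrite !trmx_mul trmxK Msym mulmxA.
Qed.
Lemma bil_sum (I : finType) (Q : I -> 'M[R]_m) (l : I -> R) u v :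
  bil (\sum_i l i *: Q i) u v = \sum_i l i * bil (Q i) u v.
Proof.
rewrite /bil mulmx_sumr mulmx_suml summxE; apply: eq_bigr => i _.
by rewrite -scalemxAr -scalemxAl mxE.
Qed.
Lemma bilDm M N u v : bil (M + N) u v = bil M u v + bil N u v.
Proof. by rewrite /bil mulmxDr mulmxDl mxE. Qed.
Lemma bilZm a M u v : bil (a *: M) u v = a * bil M u v.
Proof. by rewrite /bil -scalemxAr -scalemxAl mxE. Qed.

Lemma trmx_comb (I : finType) (Q : I -> 'M[R]_m) (l : I -> R) :
  (forall i, (Q i)^T = Q i) -> (\sum_i l i *: Q i)^T = \sum_i l i *: Q i.
Proof. by move=> Qs; rewrite linear_sum; apply: eq_bigr => i _; rewrite linearZ /= Qs. Qed.

End Bilinear.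

Local Notation dot := (bil 1%:M).

Definition bilE := (bilDl, bilDr, bilZl, bilZr, bilNl, bilNr).

(** * Common zeros of two quadratic forms *)
Lemma exists_outside_span (F : fieldType) n (u v : 'cV[F]_n) : (3 <= n)%N ->
  exists m : 'cV[F]_n, forall x y, m <> x *: u + y *: v.
Proof.
move=> n3; pose B := col_mx u^T v^T.
have: ~~ (1%:M <= B)%MS.
  apply/negP => /mxrankS; rewrite mxrank1 => /leq_trans/(_ (rank_leq_row B)).
  by rewrite leqNgt (leq_trans _ n3).
case/row_subPn => i; rewrite row1 => iB.
exists (delta_mx 0 i)^T => x y /(congr1 trmx); rewrite trmxK => dE.
move/negP: iB; apply; rewrite dE linearD !linearZ /=.
by rewrite addmx_sub ?scalemx_sub// -addsmxE ?addsmxSl ?addsmxSr.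
Qed.

Section CommonZero.
Context (R : rcfType) (n : nat).
Implicit Types (F G M : 'M[R]_n) (u v w m : 'cV[R]_n).

(** [F] vanishes on the whole plane spanned by [u] and [v], so the segment from
    [u] to [v] is a path inside [F = 0] along which [G] changes sign. *)
Lemma common_zero_segment F G u v :
    F^T = F -> G^T = G -> bil F u u = 0 -> bil F v v = 0 -> bil F u v = 0 ->
    0 < bil G u u -> bil G v v <= 0 -> (forall a, v <> a *: u) ->
  exists2 w, w != 0 & bil F w w = 0 /\ bil G w w = 0.
Proof.
move=> Fs Gs Fu Fv Fuv Gu Gv indep.
pose p : {poly R} := (bil G u u)%:P * ((1 - 'X) * (1 - 'X))
   + (2 * bil G u v)%:P * 'X * (1 - 'X) + (bil G v v)%:P * ('X * 'X).
have [|x _] := @poly_ivt R (- p) 0 1 ler01.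
  by rewrite /p !hornerE /=; lra.
rewrite rootN /root /p !hornerE => /eqP px.
exists ((1 - x) *: u + x *: v).
  apply/eqP => /eqP; rewrite addr_eq0 -scaleNr => /eqP w0.
  have [x0|x0] := eqVneq x 0.
    move: Gu; have := w0; rewrite x0 subr0 oppr0 scale0r scale1r => ->.
    by rewrite bil0l ltxx.
  apply: (indep (- x^-1 * (1 - x))); rewrite -scalerA w0 scalerA.
  by rewrite mulrNN mulVf// scale1r.
split; rewrite !bilE (bilC v u)//; first by rewrite Fu Fv Fuv; ring.
by rewrite -[RHS]px /=; ring.
Qed.

(** [u] and [v] can be joined, up to sign, by a path of nonzero vectors inside the
    cone [F = 0]; along it [G] changes sign. Dimension 3 is what makes such a path
    available: a vector outside the plane of [u] and [v] completes the cone to one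
    over a conic. *)
Lemma common_zero F G u v : (3 <= n)%N ->
    F^T = F -> G^T = G -> bil F u u = 0 -> bil F v v = 0 ->
    0 < bil G u u -> bil G v v < 0 ->
  exists2 w, w != 0 & bil F w w = 0 /\ bil G w w = 0.
Proof.
move=> n3 Fs Gs Fu Fv Gu Gv.
have indep a b : a *: u + b *: v = 0 -> a = 0 /\ b = 0.
  move=> ab0.
  have e : a ^+ 2 * bil G u u = b ^+ 2 * bil G v v.
    have -> : b ^+ 2 * bil G v v = bil G (b *: v) (b *: v) by rewrite !bilE; ring.
    have -> : b *: v = - (a *: u) by apply/eqP; rewrite -addr_eq0 addrC ab0.
    by rewrite !bilE; ring.
  have a0 : a ^+ 2 * bil G u u = 0.
    apply/eqP; rewrite eq_le; apply/andP; split; last by rewrite mulr_ge0 ?sqr_ge0 ?ltW.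
    by rewrite e mulr_ge0_le0 ?sqr_ge0 ?ltW.
  split; apply/eqP.
    by move/eqP: a0; rewrite mulf_eq0 sqrf_eq0 (gt_eqF Gu) orbF.
  by move/eqP: a0; rewrite e mulf_eq0 sqrf_eq0 (lt_eqF Gv) orbF.
have [kap0|kap0] := eqVneq (bil F u v) 0.
  apply: (@common_zero_segment F G u v) => //; first exact: ltW.
  by move=> a va; have := indep a (-1); rewrite scaleN1r -va subrr => /(_ erefl)[_]; lra.
set kap := bil F u v in kap0 *.
have [m mP] := exists_outside_span u v n3.
set a := bil F u m; set b := bil F v m; set c := bil F m m.
have indep3 x y t : x *: u + y *: v + t *: m = 0 -> [/\ x = 0, y = 0 & t = 0].
  move=> e0; have [t0|t0] := eqVneq t 0.
    by move: e0; rewrite t0 scale0r addr0 => /indep[-> ->].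
  case: (mP (- t^-1 * x) (- t^-1 * y)); rewrite -!scalerA -scalerDr.
  have -> : x *: u + y *: v = - (t *: m) by apply/eqP; rewrite -addr_eq0 e0.
  by rewrite scalerN scaleNr opprK scalerA mulVf ?scale1r.
have Fw x y t : let w := x *: u + y *: v + t *: m in
    bil F w w = 2 * kap * x * y + 2 * t * (a * x + b * y) + c * t ^+ 2.
  by rewrite /= !bilE Fu Fv (bilC v u)// (bilC m u)// (bilC m v)// -/kap -/a -/b -/c; ring.
have Gw x y t : let w := x *: u + y *: v + t *: m in
    bil G w w = x ^+ 2 * bil G u u + y ^+ 2 * bil G v v + t ^+ 2 * bil G m m
     + 2 * x * y * bil G u v + 2 * x * t * bil G u m + 2 * y * t * bil G v m.
  by rewrite /= !bilE (bilC v u)// (bilC m u)// (bilC m v)//; ring.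
have [deg|ndeg] := eqVneq (2 * a * b - c * kap) 0.
  (* [F] is a product of two linear forms on the span of [u], [v], [m]; one
     vanishes at [u], the other at [v], and both vanish at [w]. *)
  pose w := (- b) *: u + (- a) *: v + kap *: m.
  have Fww : bil F w w = 0.
    by rewrite Fw; transitivity (- kap * (2 * a * b - c * kap)); [ring|rewrite deg mulr0].
  have Fuw : bil F u w = 0.
    by rewrite /w !bilE Fu -/kap -/a; ring.
  have Fvw : bil F v w = 0.
    by rewrite /w !bilE Fv (bilC v u)// -/kap -/b; ring.
  have [Gw0|Gw0] := lerP (bil G w w) 0.
    apply: (@common_zero_segment F G u w) => // x wx.
    have := indep3 (- b - x) (- a) kap; case; last by move=> _ _ /eqP; rewrite (negPf kap0).
    by rewrite scalerBl -addrA addrAC addrA -/w wx subrr.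
  apply: (@common_zero_segment F G w v) => //; [by rewrite bilC|exact: ltW|].
  move=> x vx; have := indep3 (- b * x) (- a * x - 1) (kap * x).
  case.
    transitivity (x *: w - v); last by rewrite -vx subrr.
    rewrite /w !scalerDr !scalerA scalerBl scale1r ![_ * x]mulrC.
    by rewrite -!addrA; congr (_ + (_ + _)); rewrite addrC.
  move=> _ ax /eqP; rewrite mulf_eq0 (negPf kap0) /= => /eqP x0; move: ax; rewrite x0; lra.
(* The conic [F = 0] is parametrised by the lines through [u]; the parameter
   runs over a segment, from [2 *: v] at 0 to a nonzero multiple of [u] at 1. *)
pose xp : {poly R} := - 'X * ((2 * b)%:P * (1 - 'X * (1 + a%:P)) + (c * kap)%:P * 'X).
pose yp : {poly R} := 2%:P * (1 - 'X * (1 + a%:P)) * (1 - 'X).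
pose tp : {poly R} := (2 * kap)%:P * 'X * (1 - 'X).
pose p : {poly R} := xp * xp * (bil G u u)%:P + yp * yp * (bil G v v)%:P
   + tp * tp * (bil G m m)%:P
   + 2%:P * xp * yp * (bil G u v)%:P + 2%:P * xp * tp * (bil G u m)%:P
   + 2%:P * yp * tp * (bil G v m)%:P.
have pE s : p.[s] = let w := xp.[s] *: u + yp.[s] *: v + tp.[s] *: m in bil G w w.
  by rewrite /= Gw /p !hornerE /=; ring.
have [|s _] := @poly_ivt R p 0 1 ler01.
  rewrite !pE /= !Gw /xp /yp /tp !hornerE /=; apply/andP; split.
    by rewrite [leLHS](_ : _ = 4 * bil G v v); [lra|ring].
  rewrite [leRHS](_ : _ = (2 * a * b - c * kap) ^+ 2 * bil G u u); last by ring.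
  by rewrite mulr_ge0 ?sqr_ge0 ?ltW.
rewrite /root pE => /eqP /= Gws.
exists (xp.[s] *: u + yp.[s] *: v + tp.[s] *: m); last first.
  by split => //; rewrite Fw /xp /yp /tp !hornerE /=; ring.
apply/eqP => /indep3[]; rewrite /xp /yp /tp !hornerE => x0 y0 t0.
have [s1|s1] := eqVneq s 1.
  move: x0; rewrite s1 => /eqP; rewrite [X in X == 0](_ : _ = 2 * a * b - c * kap); last by ring.
  by rewrite (negPf ndeg).
have s1' : 1 - s != 0 by rewrite subr_eq0 eq_sym.
move/eqP: t0; rewrite !mulf_eq0 (negPf kap0) (negPf s1') pnatr_eq0 /= orbF => /eqP s0.
by move: y0; rewrite s0; lra.
Qed.
End CommonZero.

(** * Convexity of the joint range of three forms *)
Lemma sum3E (R : nmodType) (F : 'I_3 -> R) : \sum_i F i = F 0 + F 1 + F 2%:R.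
Proof.
rewrite !big_ord_recl big_ord0 addr0 addrA.
by congr (F _ + F _ + F _); apply: val_inj.
Qed.

Lemma ord3P (P : 'I_3 -> Prop) : P 0 -> P 1 -> P 2%:R -> forall i, P i.
Proof.
move=> P0 P1 P2 [[|[|[|//]]] lt_i].
- by rewrite (_ : Ordinal lt_i = 0) //; apply: val_inj.
- by rewrite (_ : Ordinal lt_i = 1) //; apply: val_inj.
- by rewrite (_ : Ordinal lt_i = 2%:R) //; apply: val_inj.
Qed.

Section JointRange.
Context (R : rcfType) (n : nat) (Q : 'I_3 -> 'M[R]_n) (theta : 'I_3 -> R).
Hypothesis n3 : (3 <= n)%N.
Hypothesis Qsym : forall i, (Q i)^T = Q i.
Hypothesis Qpd : forall x, x != 0 -> 0 < \sum_i theta i * bil (Q i) x x.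

(** The joint range is a cone, and definiteness fixes the sign of the ratio. *)
Lemma joint_range_scale (s : 'cV[R]_n) (c : 'I_3 -> R) :
    s != 0 -> 0 <= \sum_i theta i * c i ->
    (forall i j, c i * bil (Q j) s s = c j * bil (Q i) s s) ->
  exists w, forall i, bil (Q i) w w = c i.
Proof.
move=> /Qpd; set ts := \sum_i _ => ts0 tc0 par; set tc := \sum_i _ in tc0.
exists (Num.sqrt (tc / ts) *: s) => i.
rewrite bilZl bilZr mulrA -expr2 sqr_sqrtr; last by rewrite divr_ge0 // ltW.
have e : c i * ts = tc * bil (Q i) s s.
  rewrite mulr_sumr mulr_suml; apply: eq_bigr => j _.
  by rewrite mulrCA par mulrA.
by rewrite mulrAC -e mulfK// gt_eqF.
Qed.

(** Two linear functionals cut out the line of the target value. Their pullbacks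
    are quadratic forms to which [common_zero] applies; a nonzero common zero has
    its value on that line, on the right side of 0 by definiteness. *)
Lemma joint_range_convex (u v : 'cV[R]_n) :
  exists w, forall i, bil (Q i) w w = bil (Q i) u u + bil (Q i) v v.
Proof.
have [->|u0] := eqVneq u 0; first by exists v => i; rewrite bil0l add0r.
have Nge0 x : 0 <= \sum_i theta i * bil (Q i) x x.
  have [->|/Qpd/ltW//] := eqVneq x 0; rewrite big1 // => i _.
  by rewrite bil0l mulr0.
pose p i := bil (Q i) u u; pose r i := bil (Q i) v v.
pose c i := p i + r i.
have Nc0 : 0 <= \sum_i theta i * c i.
  under eq_bigr do rewrite mulrDr.
  by rewrite big_split /= addr_ge0 //; exact: Nge0.
pose cross (a b : 'I_3 -> R) (i : 'I_3) := a (i + 1) * b (i + 2%:R) - a (i + 2%:R) * b (i + 1).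
have crossE a b : [/\ cross a b 0 = a 1 * b 2%:R - a 2%:R * b 1,
   cross a b 1 = a 2%:R * b 0 - a 0 * b 2%:R &
   cross a b 2%:R = a 0 * b 1 - a 1 * b 0].
  rewrite /cross; split; congr (a _ * b _ - a _ * b _); by apply: val_inj.
pose eta := cross p r; pose g := cross c eta.
have [e0 e1 e2] := crossE p r; have [g0 g1 g2] := crossE c eta.
rewrite -/eta in e0 e1 e2; rewrite -/g in g0 g1 g2.
pose N2 := eta 0 ^+ 2 + eta 1 ^+ 2 + eta 2%:R ^+ 2.
have [N20|N2neq] := eqVneq N2 0.
  have [E0 E1 E2] : [/\ eta 0 = 0, eta 1 = 0 & eta 2%:R = 0].
    by move/eqP: N20; rewrite /N2 !paddr_eq0 ?addr_ge0 ?sqr_ge0 // !sqrf_eq0 => /andP[/andP[/eqP-> /eqP->] /eqP->].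
  have par : forall i j, c i * p j = c j * p i.
    by rewrite /c; do 2!(apply: ord3P); lra.
  exact: (@joint_range_scale u c).
(* [F] vanishes at [u] and [v]. The second functional is orthogonal to the target
   [c], so that its values [N2] at [u] and [- N2] at [v] are opposite. *)
have N2gt0 : 0 < N2 by rewrite lt_neqAle eq_sym N2neq !addr_ge0 ?sqr_ge0.
pose F := \sum_i eta i *: Q i; pose G := \sum_i g i *: Q i.
have symS l := trmx_comb l Qsym.
have formE l x : bil (\sum_i l i *: Q i) x x
    = l 0 * bil (Q 0) x x + l 1 * bil (Q 1) x x + l 2%:R * bil (Q 2%:R) x x.
  by rewrite bil_sum sum3E.
have formu l : bil (\sum_i l i *: Q i) u u = l 0 * p 0 + l 1 * p 1 + l 2%:R * p 2%:R.
  exact: formE.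
have formv l : bil (\sum_i l i *: Q i) v v = l 0 * r 0 + l 1 * r 1 + l 2%:R * r 2%:R.
  exact: formE.
have [||||w w0 [Fw Gw]] := @common_zero R n F G u v n3 (symS _) (symS _).
- by rewrite formu e0 e1 e2; ring.
- by rewrite formv e0 e1 e2; ring.
- rewrite formu g0 g1 g2 [ltRHS](_ : _ = N2)//.
  by rewrite /N2 /c e0 e1 e2; ring.
- rewrite formv g0 g1 g2 -oppr_gt0 [ltRHS](_ : _ = N2)//.
  by rewrite /N2 /c e0 e1 e2; ring.
apply: (@joint_range_scale w) => //.
pose s i := bil (Q i) w w.
have formw l : bil (\sum_i l i *: Q i) w w = l 0 * s 0 + l 1 * s 1 + l 2%:R * s 2%:R.
  exact: formE.
rewrite formw in Fw; rewrite formw in Gw.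
(* The value [s] at [w] is orthogonal to [eta] and to [g], hence parallel to [c]. *)
have D k : cross s c k = 0.
  apply: (mulfI N2neq); rewrite mulr0.
  suff -> : N2 * cross s c k = eta k * (g 0 * s 0 + g 1 * s 1 + g 2%:R * s 2%:R)
      + cross eta c k * (eta 0 * s 0 + eta 1 * s 1 + eta 2%:R * s 2%:R).
    by rewrite Fw Gw !mulr0 addr0.
  have [x0 x1 x2] := crossE s c; have [y0 y1 y2] := crossE eta c.
  move: k; apply: ord3P; rewrite ?x0 ?x1 ?x2 ?y0 ?y1 ?y2 /N2 g0 g1 g2 e0 e1 e2 /c; ring.
have [] := crossE s c; rewrite !D => d0 d1 d2.
have par : forall i j, c i * s j = c j * s i by do 2!apply: ord3P; lra.
exact: par.
Qed.
End JointRange.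

(** * Separation of convex sets *)
Section Topology.
Context (R : realType).

Lemma trmx_continuous m n : continuous (@trmx R m n).
Proof.
move=> M s /nbhs_ballP[e e0 es]; apply/nbhs_ballP; exists e => // N [_ MN].
by apply: es; split => // i j; rewrite !mxE; exact: MN.
Qed.

Lemma col_mx_continuousl m n p (C : 'M[R]_(n, p)) :
  continuous (fun M : 'M[R]_(m, p) => col_mx M C).
Proof.
move=> M s /nbhs_ballP[e e0 es]; apply/nbhs_ballP; exists e => // N [_ MN].
apply: es; split => // i j; rewrite !mxE; case: (fintype.split i) => k; first exact: MN.
exact: ballxx.
Qed.

Lemma bil_continuous n (M : 'M[R]_n) : continuous (fun x => bil M x x).
Proof.
have -> : (fun x => bil M x x) =
    (fun x => \sum_j (\sum_i x i 0 * M i j) * x j 0).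
  apply/funext => x; rewrite /bil mxE; apply: eq_bigr => j _; congr (_ * _).
  by rewrite mxE; apply: eq_bigr => i _; rewrite mxE.
apply: (@continuous_big R); first exact: add_continuous.
move=> j _ x; apply: continuousM; last exact: coord_continuous.
apply: (@continuous_big R); first exact: add_continuous.
move=> i _ {}x; apply: continuousM; first exact: coord_continuous.
exact: cst_continuous.
Qed.

Lemma cV_bounded_closed_compact n (A : set 'cV[R]_n) (B : R) :
  closed A -> (forall x, A x -> forall i, `|x i 0| <= B) -> compact A.
Proof.
move=> clA bA; pose A' : set 'rV[R]_n := trmx @^-1` A.
have -> : A = trmx @` A'.
  apply/seteqP; split => [x Ax|_ [x A'x <-]//].
  by exists x^T; rewrite /A' /= trmxK.
apply: continuous_compact.
  by apply: continuous_subspaceT => ?; exact: trmx_continuous.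
apply: bounded_closed_compact; last first.
  by apply: preimage_closed clA => x _; exact: trmx_continuous.
exists `|B|; split; first exact: num_real.
move=> M BM x A'x; rewrite /Num.norm /= mx_normrE; apply/bigmax_leP; split.
  by rewrite ltW// (le_lt_trans _ BM).
move=> [i j] _ /=; rewrite ord1; have := bA _ A'x j; rewrite mxE => /le_trans; apply.
by rewrite (le_trans (ler_norm _))// ltW.
Qed.

Lemma dotE n (x y : 'cV[R]_n) : dot x y = \sum_i x i 0 * y i 0.
Proof. by rewrite /bil mulmx1 mxE; apply: eq_bigr => i _; rewrite mxE. Qed.

Lemma dot_sqE n (x : 'cV[R]_n) : dot x x = \sum_i x i 0 ^+ 2.
Proof. exact: dotE. Qed.

Lemma dot_ge0 n (x : 'cV[R]_n) : 0 <= dot x x.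
Proof. by rewrite dot_sqE sumr_ge0// => i _; exact: sqr_ge0. Qed.

Lemma coord_le_dot n (x : 'cV[R]_n) i : x i 0 ^+ 2 <= dot x x.
Proof.
by rewrite dot_sqE (bigD1 i)//= lerDl sumr_ge0// => j _; exact: sqr_ge0.
Qed.

Lemma dot_gt0 n (x : 'cV[R]_n) : x != 0 -> 0 < dot x x.
Proof.
move=> x0; rewrite lt_neqAle dot_ge0 andbT eq_sym; apply: contra x0 => /eqP x0.
apply/eqP/matrixP => i j; rewrite ord1 mxE; apply/eqP; rewrite -sqrf_eq0.
by rewrite eq_le sqr_ge0 andbT -x0 coord_le_dot.
Qed.

Lemma convex_setP (V : lmodType R) (X : set V) :
  @convex_set R V X <->
  forall x y t, 0 <= t -> t <= 1 -> X x -> X y -> X (t *: x + (1 - t) *: y).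
Proof.
split=> [cX x y t t0 t1 Xx Xy|cX x y t]; last first.
  by rewrite !inE => Xx Xy; apply: cX.
have t01 : Itv.spec (@Itv.num_sem R) (Itv.Real `[0%Z, 1%Z]) t.
  by rewrite /Itv.num_sem /= num_real in_itv /= t0 t1.
pose tt : {i01 R} := Itv.mk t01.
have := cX x y tt; rewrite !inE; exact.
Qed.

Lemma convex_hull_convex (V : lmodType R) (X : set V) :
  @convex_set R V (convex_hull X).
Proof.
apply/convex_setP => x y t t0 t1 hx hy C [/= cC XC].
by move/convex_setP : (cC); apply => //; [exact: hx|exact: hy].
Qed.

Lemma sub_convex_hull (V : lmodType R) (X : set V) : X `<=` convex_hull X.
Proof. by move=> x Xx C [_]; exact. Qed.

Lemma convex_hull_sub (V : lmodType R) (X Y : set V) :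
  @convex_set R V Y -> X `<=` Y -> convex_hull X `<=` Y.
Proof. by move=> cY XY x; apply. Qed.

Lemma linear_slope_ge0 (a b : R) :
  (forall t, 0 < t -> t <= 1 -> 0 <= 2 * a * t + b * t ^+ 2) -> 0 <= a.
Proof.
move=> h; rewrite leNgt; apply/negP => a0.
pose t := Num.min 1 (- a / (`|b| + 1)).
have b1 : 0 < `|b| + 1 by rewrite ltr_wpDl.
have t0 : 0 < t by rewrite lt_min ltr01 divr_gt0// oppr_gt0.
have t1 : t <= 1 by rewrite ge_min lexx.
have bt : b * t <= - a.
  rewrite (le_trans (ler_norm _))// normrM (gtr0_norm t0).
  rewrite (@le_trans _ _ ((`|b| + 1) * t))//; first by rewrite ler_wpM2r ?lerDl // ltW.
  by rewrite -ler_pdivlMl// mulrC ge_min lexx orbT.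
have := h t t0 t1; rewrite (_ : _ + _ = (2 * a + b * t) * t); last by ring.
by rewrite pmulr_lge0// => ?; lra.
Qed.

Lemma affine_continuous n (a : 'cV[R]_n) (t : R) :
  continuous (fun q : 'cV[R]_n => a + t *: q).
Proof.
move=> q; apply: continuousD; first exact: cst_continuous.
exact: scaler_continuous.
Qed.

(** The normal points from the nearest point [p] of the closure towards [y]. *)
Lemma strict_separation n (X : set 'cV[R]_n) (y : 'cV[R]_n) :
    @convex_set R 'cV[R]_n X -> X !=set0 -> ~ closure X y ->
  exists alpha beta, (forall x, X x -> dot alpha x <= beta)
     /\ beta < dot alpha y.
Proof.
move=> /convex_setP cX [x0 Xx0] Xy.
pose f (x : 'cV[R]_n) := dot (x - y) (x - y).
have fC : continuous f.
  move=> x; apply: (@continuous_comp _ _ _ (fun z : 'cV[R]_n => z - y) (fun z => dot z z)).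
    by apply: continuousB; [exact: cvg_id|exact: cst_continuous].
  exact: bil_continuous.
pose K := closure X `&` f @^-1` [set r | r <= f x0].
have clK : closed K.
  apply: closedI; first exact: closed_closure.
  by apply: preimage_closed; [move=> x _; exact: fC|exact: closed_le].
have coK : compact K.
  apply: (@cV_bounded_closed_compact _ _ (1 + f x0 + \sum_i `|y i 0|) clK).
  move=> x [_ /= fx] i.
  have : `|(x - y) i 0| <= 1 + f x0.
    have := coord_le_dot (x - y) i; rewrite -/(f x) => /le_trans/(_ fx).
    rewrite -[_ ^+ 2]real_normK ?num_real//.
    have : 0 <= `|(x - y) i 0| by [].
    nra.
  have : `|x i 0| <= `|(x - y) i 0| + `|y i 0|.
    by rewrite (le_trans _ (ler_normD _ _))// !mxE subrK.
  have : `|y i 0| <= \sum_j `|y j 0| by rewrite (bigD1 i)//= lerDl sumr_ge0.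
  by lra.
have [||p] := @compact_EVT_min _ R f K _ coK.
- by exists x0; split; [exact: subset_closure|rewrite /=].
- by apply: continuous_subspaceT => ?; exact: fC.
rewrite inE => -[clp fp] pmin.
have {}pmin z : closure X z -> f p <= f z.
  move=> clz; have [fz|/ltW fz] := lerP (f z) (f x0); last exact: le_trans fp fz.
  by apply: pmin; rewrite inE.
exists (y - p), (dot (y - p) p); split; last first.
  rewrite -subr_gt0 -bilNr -bilDr dot_gt0// subr_eq0.
  by apply: contra_notN Xy => /eqP ->.
move=> x Xx; rewrite -subr_ge0.
apply: (@linear_slope_ge0 _ (dot (x - p) (x - p))) => t t0 t1.
have clz : closure X (t *: x + (1 - t) *: p).
  move=> B /=; have cont := @affine_continuous n (t *: x) (1 - t) p.
  move/cont => /clp[q [Xq Bq]]; exists (t *: x + (1 - t) *: q); split => //.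
  by apply: cX => //; exact: ltW.
have := pmin _ clz; rewrite -subr_ge0 /f.
rewrite (_ : t *: x + (1 - t) *: p - y = (p - y) + t *: (x - p)); last first.
  by rewrite scalerBr scalerBl scale1r; apply/matrixP => i j; rewrite !mxE; ring.
have symI : (1%:M : 'M[R]_n)^T = 1%:M by rewrite trmx1.
have -> : dot (y - p) p - dot (y - p) x = dot (p - y) (x - p).
  by rewrite -[p - y]opprB -[x - p]opprB bilNl bilNr opprK bilDr bilNr.
move: (x - p) (p - y) => q d /le_trans; apply.
rewrite !bilE (bilC q d)// le_eqVlt; apply/orP; left; apply/eqP; ring.
Qed.

End Topology.

(** * Theorems of the alternative *)
Section Alternative.
Context (R : realType).

(** The values lying above the joint range form a convex cone that does not meet
    the open negative octant; separate it from a point there. *)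
Lemma alternative n (Q : 'I_3 -> 'M[R]_n) (theta : 'I_3 -> R) :
    (3 <= n)%N -> (forall i, (Q i)^T = Q i) ->
    (forall x, x != 0 -> 0 < \sum_i theta i * bil (Q i) x x) ->
    (forall w, exists i, 0 <= bil (Q i) w w) ->
  exists l : 'I_3 -> R, [/\ forall i, 0 <= l i, 0 < \sum_i l i &
    forall w, 0 <= \sum_i l i * bil (Q i) w w].
Proof.
move=> n3 Qs Qpd noneg.
pose X : set 'cV[R]_3 := [set c | exists w, forall i, bil (Q i) w w <= c i 0].
have scX c t : 0 <= t -> X c -> X (t *: c).
  move=> t0 [w wc]; exists (Num.sqrt t *: w) => i.
  by rewrite bilZl bilZr mulrA -expr2 sqr_sqrtr// mxE ler_wpM2l.
have addX c c' : X c -> X c' -> X (c + c').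
  move=> [w wc] [w' wc']; have [v vE] := joint_range_convex n3 Qs Qpd w w'.
  by exists v => i; rewrite vE mxE lerD.
have cX : @convex_set R 'cV[R]_3 X.
  by apply/convex_setP => x y t t0 t1 Xx Xy; apply: addX; apply: scX; rewrite ?subr_ge0.
have X0 : X 0 by exists 0 => i; rewrite bil0l mxE.
pose y : 'cV[R]_3 := const_mx (- 1).
have [||al [be [Xal alm]]] := @strict_separation R 3 X y cX.
- by exists 0.
- move=> /(_ (ball y 1)) [].
    exact: nbhsx_ballx.
  move=> c [[w wc] [_ cb]]; have [h hge] := noneg w.
  have := cb h 0; rewrite /y mxE /ball /= => ci.
  have := wc h; have := ler_norm (c h 0 - (- 1)); rewrite distrC.
  by lra.
(* [X] is a cone, so a bound on it forces a nonpositive functional. *)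
have alX c : X c -> dot al c <= 0.
  move=> Xc; rewrite leNgt; apply/negP => ac.
  have be0 : 0 <= be by have := Xal 0 X0; rewrite bil0r.
  have := Xal _ (scX c ((be + 1) / dot al c) _ Xc).
  rewrite bilZr divfK ?gt_eqF// => /(_ _); rewrite gerDl ler10 => h.
  by have /h : 0 <= (be + 1) / dot al c by rewrite divr_ge0 ?addr_ge0// ltW.
exists (fun i => - al i 0); split.
- move=> i; rewrite oppr_ge0; have := alX (delta_mx i 0).
  rewrite dotE (bigD1 i)//= mxE !eqxx mulr1 big1 ?addr0 => [|j /negPf ji].
    by apply; exists 0 => j; rewrite bil0l mxE ler0n.
  by rewrite mxE ji mulr0.
- have be0 : 0 <= be by have := Xal 0 X0; rewrite bil0r.
  rewrite (le_lt_trans be0)// (lt_le_trans alm)// dotE le_eqVlt.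
  by apply/orP; left; apply/eqP/eq_bigr => i _; rewrite /y mxE mulrN1.
- move=> w; have := alX (\col_i bil (Q i) w w).
  rewrite dotE -oppr_ge0 -sumrN => h.
  have : X (\col_i bil (Q i) w w) by exists w => i; rewrite mxE.
  move=> /h; rewrite (eq_bigr (fun i => - al i 0 * bil (Q i) w w)) // => i _.
  by rewrite mxE mulNr.
Qed.

Lemma max_continuous (T : topologicalType) (f g : T -> R) :
  continuous f -> continuous g -> continuous (fun x => Num.max (f x) (g x)).
Proof. by move=> cf cg x; apply: continuous_max; [exact: cf|exact: cg]. Qed.

(** By compactness the hypothesis persists when a small multiple of the definite
    combination is subtracted from each form. The new forms stay in the same
    pencil, so that [alternative] still applies to them. *)
Lemma alternative_strict n (Q : 'I_3 -> 'M[R]_n) (theta : 'I_3 -> R) :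
    (3 <= n)%N -> (forall i, (Q i)^T = Q i) ->
    (forall x, x != 0 -> 0 < \sum_i theta i * bil (Q i) x x) ->
    (forall w, w != 0 -> exists i, 0 < bil (Q i) w w) ->
  exists l : 'I_3 -> R, [/\ forall i, 0 <= l i, 0 < \sum_i l i &
    forall w, w != 0 -> 0 < \sum_i l i * bil (Q i) w w].
Proof.
move=> n3 Qs Qpd pos.
pose S : set 'cV[R]_n := (fun x => dot x x) @^-1` [set 1].
have clS : closed S.
  apply: preimage_closed; first by move=> x _; exact: bil_continuous.
  exact: closed_eq.
have coS : compact S.
  apply: (@cV_bounded_closed_compact R n S 1 clS) => x /= Sx i.
  by have := coord_le_dot x i; rewrite Sx -[_ ^+ 2]real_normK ?num_real// expr_le1.
have S0 : S !=set0.
  pose i0 : 'I_n := Ordinal (leq_trans (isT : (0 < 3)%N) n3).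
  exists (delta_mx i0 0); rewrite /S /= dot_sqE (bigD1 i0)//= big1 ?addr0 => [|j /negPf j0].
    by rewrite mxE !eqxx expr1n.
  by rewrite mxE j0 expr0n.
have SN0 x : S x -> x != 0.
  by move=> Sx; apply: contra_eqN Sx => /eqP ->; rewrite bil0l eq_sym oner_neq0.
pose psi x := Num.max (Num.max (bil (Q 0) x x) (bil (Q 1) x x)) (bil (Q 2%:R) x x).
have psiC : continuous psi.
  by apply: max_continuous; [apply: max_continuous|]; exact: bil_continuous.
have psiE x : exists i, psi x = bil (Q i) x x.
  rewrite /psi; case: (leP _ (bil (Q 2%:R) x x)) => _; first by exists 2%:R.
  by case: leP => _; [exists 1|exists 0].
have psi_gt x a : (exists i, a < bil (Q i) x x) -> a < psi x.
  case; apply: ord3P => h; rewrite /psi !lt_max h ?orbT//.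
have [c] := compact_EVT_min S0 coS (continuous_subspaceT psiC).
rewrite inE => Sc psimin.
have m0 : 0 < psi c by apply: psi_gt; apply: pos; exact: SN0.
pose N := \sum_i theta i *: Q i.
have NE x : bil N x x = \sum_i theta i * bil (Q i) x x by rewrite bil_sum.
have [c' ] := compact_EVT_max S0 coS (continuous_subspaceT (@bil_continuous R n N)).
rewrite inE => Sc' Nmax.
have C0 : 0 < bil N c' c' by rewrite NE Qpd// SN0.
set m := psi c in m0 psimin; set C := bil N c' c' in C0 Nmax.
pose st := \sum_i theta i.
(* The first bound keeps some form above [e * N] on the sphere, the second one
   keeps the new pencil definite. *)
pose e := Num.min (m / C) (1 / (2 * (`|st| + 1))).
have e0 : 0 < e.
  by rewrite lt_min !divr_gt0// mulr_gt0// ltr_wpDl.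
have eC : e * C <= m by rewrite -ler_pdivlMr// ge_min lexx.
have est : e * st < 1.
  have : e * (2 * (`|st| + 1)) <= 1.
    by rewrite -ler_pdivlMr ?ge_min ?lexx ?orbT// mulr_gt0// ltr_wpDl.
  have : e * st <= e * `|st| by rewrite ler_wpM2l ?ler_norm// ltW.
  have : 0 <= e * `|st| by rewrite mulr_ge0// ltW.
  by lra.
pose Q' i := Q i - e *: N.
have Q'E i x : bil (Q' i) x x = bil (Q i) x x - e * bil N x x.
  by rewrite /Q' bilDm -scaleNr bilZm mulNr.
have [|||l [l0 ls lpos]] := @alternative n Q' theta n3.
- move=> i; rewrite /Q' linearB linearZ /= Qs; congr (_ - _ *: _).
  exact: trmx_comb.
- move=> x x0; have := Qpd x x0; rewrite -NE => Nx.
  under eq_bigr => i _ do rewrite Q'E mulrBr.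
  rewrite sumrB -NE -mulr_suml mulrA -/st.
  have : 0 < (1 - e * st) * bil N x x by rewrite mulr_gt0// subr_gt0.
  by rewrite mulrBl mul1r [st * e]mulrC.
- move=> w; have [->|w0] := eqVneq w 0; first by exists 0; rewrite bil0l.
  have d0 := dot_gt0 w0; set d := dot w w in d0.
  pose x := (Num.sqrt d)^-1 *: w.
  have xE M : bil M w w = d * bil M x x.
    rewrite /x bilZl bilZr mulrA -expr2 exprVn sqr_sqrtr ?ltW// mulrA.
    by rewrite mulfV ?gt_eqF// mul1r.
  have Sx : S x.
    by apply: (mulfI (lt0r_neq0 d0)); rewrite /= -xE mulr1.
  have [i psix] := psiE x; exists i.
  rewrite Q'E !xE mulrCA -mulrBr; apply: mulr_ge0; first exact: ltW.
  rewrite subr_ge0 -psix.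
  have /psimin : x \in S by rewrite inE.
  have /Nmax : x \in S by rewrite inE.
  by move=> h1 h2; rewrite (le_trans _ (le_trans eC h2))// ler_pM2l.
exists l; split => // w w0; have := lpos w.
under eq_bigr => i _ do rewrite Q'E mulrBr.
rewrite sumrB subr_ge0 -mulr_suml. apply: lt_le_trans.
by rewrite !mulr_gt0// NE Qpd.
Qed.
End Alternative.

(** * Counting negative eigenvalues *)
Lemma char_poly_conj (F : comUnitRingType) n (P D : 'M[F]_n) :
  P \in unitmx -> char_poly (invmx P *m D *m P) = char_poly D.
Proof.
move=> Pu; rewrite /char_poly /char_poly_mx.
have PP : map_mx polyC (invmx P) *m map_mx polyC P = 1%:M.
  by rewrite -map_mxM mulVmx// map_mx1.
transitivity (\det (map_mx polyC (invmx P) *m ('X%:M - map_mx polyC D) *m map_mx polyC P)).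
  congr (\det _); rewrite mulmxBr mulmxBl -!map_mxM; congr (_ - _).
  by rewrite scalar_mxC -mulmxA PP mulmx1.
by rewrite !det_mulmx mulrAC -det_mulmx PP det1 mul1r.
Qed.

Lemma sum_count_le (T : eqType) (P : pred T) (r s : seq T) : uniq r ->
  (\sum_(x <- r | P x) count_mem x s <= count P s)%N.
Proof.
move=> ur; elim: s => [|y s IHs] /=; first by rewrite big1.
under eq_bigr => x _ do rewrite -/(count_mem x s).
rewrite big_split /= leq_add// {IHs}.
rewrite -big_filter; have : uniq [seq x <- r | P x] by rewrite filter_uniq.
have : all P [seq x <- r | P x] by rewrite filter_all.
elim: [seq x <- r | P x] => [|x t IHt] /=; first by rewrite big_nil.
move=> /andP[Px Pt] /andP[xt ut]; rewrite big_cons.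
have [->|yx] /= := eqVneq y x; last by rewrite add0n IHt.
rewrite Px big_seq big1 // => z zt.
by case: eqVneq => // xz; rewrite xz zt in xt.
Qed.

Section RealSpectrum.
Context (R : rcfType).
Local Notation C := (complex R).
Local Notation cmx := (map_mx (real_complex R)).

(** Two negative eigenvalues would give a plane on which the form is negative
    definite, and every plane meets the hyperplane nontrivially. The spectral theorem is used
    over the complex numbers, where it takes care of multiplicities; real and
    imaginary parts bring the witness back to real vectors. *)
Lemma num_neg_eigenvalues_le1 n (A : 'M[R]_n) (a : 'cV[R]_n) :
    A^T = A -> (forall x, dot a x = 0 -> 0 <= bil A x x) ->
  (num_neg_eigenvalues A <= 1)%N.
Proof.
move=> As psd.
have Ah : (cmx A) \is hermsymmx.
  apply: realsym_hermsym.
    by apply/is_hermitianmxP; apply/matrixP => i j; rewrite expr0 scale1r !mxE -[in LHS]As mxE.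
  by apply/mxOverP => i j; rewrite mxE; apply/complex_realP; exists (A i j).
have spr := hermitian_spectral_diag_real Ah.
have /orthomx_spectralP AE := hermitian_normalmx Ah.
set P := spectralmx (cmx A) in AE; set sp := spectral_diag (cmx A) in AE spr.
have Pu : P \is unitarymx by exact: spectral_unitarymx.
clearbody P sp.
pose d i := complex.Re (sp 0 i).
have dE i : sp 0 i = (d i)%:C%C.
  by rewrite RRe_real//; move/mxOverP: spr; apply.
have chiE : char_poly A = \prod_(x <- [seq d i | i <- enum 'I_n]) ('X - x%:P).
  apply: (@map_poly_inj _ _ (real_complex R)); rewrite map_char_poly AE.
  rewrite char_poly_conj ?unitarymx_unit// char_poly_trig ?diag_mx_is_trig//.
  rewrite rmorph_prod /= big_map big_enum; apply: eq_bigr => i _.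
  by rewrite rmorphB /= map_polyX map_polyC /= mxE eqxx dE.
rewrite /num_neg_eigenvalues.
under eq_bigr => x _ do rewrite chiE mu_prod_XsubC.
apply: leq_trans (sum_count_le _ _ _) _; first exact: uniq_roots.
rewrite count_map; set cnt := count _ _.
have -> : cnt = #|[pred i | d i < 0]|.
  by rewrite cardE /enum_mem size_filter -enumT.
rewrite leqNgt; apply/negP => /card_gt1P[i [j [di dj ij]]].
rewrite !inE in di dj.
pose rr k := ((cmx a)^T *m (P ^t* )%sesqui ) 0 k.
(* Combine the two eigenvectors so as to be orthogonal to [a]. *)
have [al [be [ab0 abn]]] : exists al be, rr i * al + rr j * be = 0 /\ (al != 0) || (be != 0).
  have [ri|ri] := eqVneq (rr i) 0.
    by exists 1, 0; rewrite ri mul0r mulr0 addr0 oner_neq0.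
  by exists (rr j), (- rr i); rewrite oppr_eq0 ri orbT; split => //; ring.
pose e : 'cV[C]_n := al *: delta_mx i 0 + be *: delta_mx j 0.
pose z := (P ^t* )%sesqui *m e.
pose x := map_mx (@complex.Re R) z; pose y := map_mx (@complex.Im R) z.
have zE : z = cmx x + 'i%C *: cmx y.
  by apply/matrixP => k l; rewrite !mxE; case: (\sum_ _ _) => u v; simpc.
have zcE : map_mx Num.conj z = cmx x - 'i%C *: cmx y.
  by apply/matrixP => k l; rewrite !mxE; case: (\sum_ _ _) => u v; simpc.
have mapE (M : 'M[R]_n) (u v : 'cV[R]_n) : bil (cmx M) (cmx u) (cmx v) = (bil M u v)%:C%C.
  by rewrite /bil map_trmx -!map_mxM mxE.
have hE : bil (cmx A) (map_mx Num.conj z) z = (bil A x x + bil A y y)%:C%C.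
  rewrite zcE [in LHS]zE !bilE !mapE (bilC y x As); simpc; congr (_ +i* _)%C; ring.
have hE' : bil (cmx A) (map_mx Num.conj z) z = al^* * al * (d i)%:C%C + be^* * be * (d j)%:C%C.
  have deltaE (M : 'M[C]_n) k l : bil M (delta_mx k 0) (delta_mx l 0) = M k l.
    by rewrite /bil trmx_delta -rowE -colE !mxE.
  transitivity (bil (diag_mx sp) (map_mx Num.conj e) e).
    rewrite /bil AE (invmx_unitary Pu).
    have -> : (map_mx Num.conj z)^T = (map_mx Num.conj e)^T *m P.
      rewrite /z map_mxM trmx_mul; congr (_ *m _).
      apply/matrixP => k l; rewrite !mxE; exact: conjCK.
    have/unitarymxP PP := Pu.
    rewrite /z -!mulmxA (mulmxA P) PP mul1mx.
    by rewrite (mulmxA P _ e) PP mul1mx.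
  have -> : map_mx Num.conj e = al^* *: delta_mx i 0 + be^* *: delta_mx j 0.
    by rewrite map_mxD 2!map_mxZ 2!map_delta_mx.
  rewrite !bilE !deltaE !mxE !eqxx (negPf ij) eq_sym (negPf ij) !dE /= !mulr1n !mulr0n; ring.
have az0 : dot (cmx a) z = 0.
  have rrE k : ((cmx a)^T *m (P ^t* )%sesqui *m (delta_mx k 0 : 'cV_n)) 0 0 = rr k.
    by rewrite -colE mxE.
  rewrite /bil mulmx1 /z mulmxA /e mulmxDr -!scalemxAr.
  rewrite [LHS]mxE [X in X + _]mxE [X in _ + X]mxE !rrE -ab0; ring.
have [ax0 ay0] : dot a x = 0 /\ dot a y = 0.
  have e1 : cmx (1%:M : 'M[R]_n) = 1%:M by rewrite map_scalar_mx rmorph1.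
  by move: az0; rewrite zE bilDr bilZr -e1 !mapE; simpc; case=> -> ->.
have : (bil A x x + bil A y y)%:C%C < 0.
  rewrite -hE hE'.
  have sq (u : C) : u^* * u = (complex.Re u ^+ 2 + complex.Im u ^+ 2)%:C%C.
    case: u => p q; rewrite [LHS](_ : _ = (p -i* q) * (p +i* q))%C//.
    by simpc; congr (_ +i* _)%C; ring.
  have sq_ge0 (u : C) : 0 <= complex.Re u ^+ 2 + complex.Im u ^+ 2.
    by rewrite addr_ge0 ?sqr_ge0.
  have sq_gt0 (u : C) : u != 0 -> 0 < complex.Re u ^+ 2 + complex.Im u ^+ 2.
    case: u => p q /= u0; rewrite lt_neqAle addr_ge0 ?sqr_ge0// andbT eq_sym.
    by apply: contra u0; rewrite paddr_eq0 ?sqr_ge0// !sqrf_eq0 => /andP[/eqP-> /eqP->].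
  rewrite !sq -!rmorphM -rmorphD ltcR.
  case/orP: abn => /sq_gt0 u0.
    by rewrite ltr_wnDr ?nmulr_llt0// mulr_ge0_le0// ltW.
  by rewrite ltr_wnDl ?nmulr_llt0// mulr_ge0_le0// ltW.
by rewrite (ltcR _ 0) ltNge addr_ge0// psd.
Qed.
End RealSpectrum.

(** * Quadratics along a line *)
Section PairsOfQuadratics.
Context (R : realType).
Implicit Types a b c s : R.

Lemma quadratic_lt0_near a b c : a < 0 ->
  exists2 s0, 0 < s0 & forall s, `|s| <= s0 -> a + b * s + c * s ^+ 2 < 0.
Proof.
move=> a0; pose D := `|b| + `|c| + 1.
have D0 : 0 < D by rewrite ltr_wpDl// addr_ge0.
exists (Num.min 1 (- a / (2 * D))).
  by rewrite lt_min ltr01 divr_gt0 ?mulr_gt0// oppr_gt0.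
move=> s; rewrite le_min => /andP[s1]; rewrite ler_pdivlMr ?mulr_gt0// => sD.
have h1 : b * s <= `|b| * `|s| by rewrite -normrM ler_norm.
have h2 : c * s ^+ 2 <= `|c| * `|s|.
  rewrite (le_trans (ler_norm _))// normrM ler_wpM2l// normrX expr2.
  by rewrite -[leRHS]mulr1 ler_wpM2l.
have := normr_ge0 s; move: sD; rewrite /D; nra.
Qed.

(** If the value at 0 were 0, it would be a local minimum: the quadratic would be
    [c * s ^+ 2] with [0 <= c], and could not be negative at - 1. *)
Lemma quadratic_gt0_of_near_ge0 a b c s0 : 0 < s0 ->
  (forall s, `|s| < s0 -> 0 <= a + b * s + c * s ^+ 2) ->
  a - b + c < 0 -> 0 < a.
Proof.
move=> s00 h neg; have a0 : 0 <= a.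
  by have := h 0; rewrite normr0 mulr0 expr0n mulr0 !addr0; apply.
rewrite lt_neqAle a0 andbT; apply/negP => /eqP a0'; subst a.
pose s := Num.min (s0 / 2) (1 / 2).
have s_gt0 : 0 < s by rewrite lt_min !divr_gt0.
have ss0 : s < s0 by rewrite gt_min [s0 / 2 < s0](_ : _ = true)//; lra.
have s1 : s <= 1 / 2 by rewrite ge_min lexx orbT.
have := h s; rewrite gtr0_norm// => /(_ ss0) hp.
have := h (- s); rewrite normrN gtr0_norm// => /(_ ss0) hm.
have {}hp : 0 <= b + c * s by rewrite -(pmulr_rge0 _ s_gt0); lra.
have {}hm : 0 <= - b + c * s by rewrite -(pmulr_rge0 _ s_gt0); lra.
have c0 : 0 <= c by rewrite -(pmulr_lge0 _ s_gt0); lra.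
have : c * s <= c * (1 / 2) by rewrite ler_wpM2l.
lra.
Qed.

Section TwoQuadratics.
Variables (a1 b1 c1 a2 b2 c2 s0 : R).
Let g1 s := a1 + b1 * s + c1 * s ^+ 2.
Let g2 s := a2 + b2 * s + c2 * s ^+ 2.
Hypothesis s00 : 0 < s0.
Hypothesis g1N : a1 - b1 + c1 < 0.
Hypothesis g2N : a2 - b2 + c2 < 0.
Hypothesis mult : forall s, `|s| < s0 -> exists p r, [/\ 0 <= p, 0 <= r, 0 < p + r,
  0 <= p * g1 s + r * g2 s & p * a1 + r * a2 <= 0].

(** Were [a2 >= 0], the combination [- a1 * g2 + a2 * g1], which vanishes at 0 and
    is negative at - 1, would be nonnegative near 0: there [g1] is negative while
    the weighted sums are not. *)
Lemma weighted_neg_left : a1 < 0 -> a2 < 0.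
Proof.
move=> a10; rewrite ltNge; apply/negP => a20.
have [s1 s10 hs1] := quadratic_lt0_near b1 c1 a10.
have mn0 : 0 < Num.min s0 s1 by rewrite lt_min s00.
suff : 0 < - a1 * a2 + a2 * a1 by lra.
apply: (@quadratic_gt0_of_near_ge0 _ (- a1 * b2 + a2 * b1) (- a1 * c2 + a2 * c1) _ mn0); last first.
  have : 0 < a1 * (a2 - b2 + c2) by rewrite nmulr_rgt0.
  have : a2 * (a1 - b1 + c1) <= 0 by rewrite mulr_ge0_le0// ltW.
  lra.
move=> s; rewrite lt_min => /andP[ss0 /ltW/hs1 g1s].
have [p [r [p0 r0 pr hg ha]]] := mult ss0; rewrite -/(g1 s) in g1s.
have r1 : 0 < r.
  rewrite lt_neqAle r0 andbT; apply/negP => /eqP r0'; move: hg pr; rewrite -r0'.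
  by move=> ? ?; nra.
rewrite [leRHS](_ : _ = - a1 * g2 s + a2 * g1 s); last by rewrite /g1 /g2; ring.
rewrite -(pmulr_rge0 _ r1).
have : 0 <= - a1 * (p * g1 s + r * g2 s) by rewrite mulr_ge0// oppr_ge0 ltW.
have : 0 <= g1 s * (p * a1 + r * a2) by rewrite mulr_le0// ltW.
by lra.
Qed.

Lemma weighted_pos_left : 0 < a1 -> 0 <= a2 -> False.
Proof.
move=> a10 a20.
have h s : `|s| < s0 -> exists r, [/\ 0 < r, 0 <= r * g2 s & r * a2 <= 0].
  move=> /mult[p [r [p0 r0 pr hg ha]]].
  have p00 : p = 0.
    have ra : 0 <= r * a2 by rewrite mulr_ge0.
    have pa : 0 <= p * a1 by rewrite mulr_ge0// ltW.
    have /eqP : p * a1 = 0 by lra.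
    by rewrite mulf_eq0 (gt_eqF a10) orbF => /eqP.
  by exists r; move: pr hg ha; rewrite p00 !mul0r !add0r.
have : 0 < a2.
  apply: (quadratic_gt0_of_near_ge0 s00 _ g2N) => s /h[r [r0 + _]].
  by rewrite pmulr_rge0.
have [r [r0 _ ra]] : exists r, [/\ 0 < r, 0 <= r * g2 0 & r * a2 <= 0].
  by apply: h; rewrite normr0.
by rewrite -(pmulr_rgt0 _ r0) ltNge ra.
Qed.
End TwoQuadratics.

(** The weights may depend on [s]. At [s = 0] they force [a1] and [a2] to have
    weakly opposite signs; the weights at nearby [s] on both sides then exclude
    every case but [a1 = a2 = 0]. *)
Lemma weighted_quadratics_vanish a1 b1 c1 a2 b2 c2 s0 : 0 < s0 ->
  a1 - b1 + c1 < 0 -> a2 - b2 + c2 < 0 ->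
  (forall s, `|s| < s0 -> exists p r, [/\ 0 <= p, 0 <= r, 0 < p + r,
    0 <= p * (a1 + b1 * s + c1 * s ^+ 2) + r * (a2 + b2 * s + c2 * s ^+ 2)
    & p * a1 + r * a2 <= 0]) ->
  a1 = 0 /\ a2 = 0.
Proof.
move=> s00 g1N g2N mult.
have mult' s : `|s| < s0 -> exists p r, [/\ 0 <= p, 0 <= r, 0 < p + r,
    0 <= p * (a2 + b2 * s + c2 * s ^+ 2) + r * (a1 + b1 * s + c1 * s ^+ 2)
    & p * a2 + r * a1 <= 0].
  move=> /mult[p [r [p0 r0 pr hg ha]]]; exists r, p; split => //; last by lra.
    by rewrite addrC.
  by rewrite addrC.
have L1 := weighted_neg_left s00 g1N g2N mult; have L2 := weighted_neg_left s00 g2N g1N mult'.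
have R1 := weighted_pos_left s00 g2N mult; have R2 := weighted_pos_left s00 g1N mult'.
have [p [r [p0 r0 pr hg _]]] : exists p r, [/\ 0 <= p, 0 <= r, 0 < p + r,
    0 <= p * (a1 + b1 * 0 + c1 * 0 ^+ 2) + r * (a2 + b2 * 0 + c2 * 0 ^+ 2)
    & p * a1 + r * a2 <= 0] by apply: mult; rewrite normr0.
have nn : a1 < 0 -> a2 < 0 -> False.
  move=> h1 h2; rewrite !expr0n /= !mulr0 !addr0 in hg.
  have [p1|] := ltP 0 p; last by nra.
  by nra.
case: (ltgtP a1 0) => h1.
- by case: (nn h1 (L1 h1)).
- case: (ltP a2 0) => h2; first by move: (L2 h2); lra.
  by case: (R1 h1 h2).
- case: (ltgtP a2 0) => h2 //; first by move: (L2 h2); lra.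
  by case: R2 => //; rewrite h1.
Qed.
End PairsOfQuadratics.

(** * Homogeneous slices *)
Section Hyperplane.
Context (R : realType) (n : nat).
Implicit Types (x y d : 'cV[R]_n) (w : 'cV[R]_(n + 1)) (M : 'M[R]_(n + 1)).

Definition height w : R := dsubmx w 0 0.
(** The point at infinity in direction [d]. *)
Definition dir d : 'cV[R]_(n + 1) := col_mx d 0.

(** The linear hyperplane spanned by the homogenisation of the affine hyperplane
    through [y] with normal [al]. *)
Definition slice (al y : 'cV[R]_n) : set 'cV[R]_(n + 1) :=
  [set w | dot al (usubmx w) = height w * dot al y].

Lemma vec_homog w : w = height w *: homog 0 + dir (usubmx w).
Proof.
rewrite -{1}[w]vsubmxK /homog /dir scale_col_mx add_col_mx scaler0 add0r addr0.
congr col_mx; apply/matrixP => i j; rewrite !ord1 /height !mxE eqxx mulr1.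
by congr (w _ _).
Qed.

Lemma homog_add_dir x d (s : R) : homog (x + s *: d) = homog x + s *: dir d.
Proof. by rewrite /homog /dir scale_col_mx add_col_mx scaler0 addr0. Qed.

Lemma homog0_dir x : homog x = homog 0 + dir x.
Proof. by rewrite -[x in LHS]add0r -[x in LHS]scale1r homog_add_dir scale1r. Qed.

Lemma dirZ (s : R) d : dir (s *: d) = s *: dir d.
Proof. by rewrite /dir scale_col_mx scaler0. Qed.

Lemma dir_eq0 d : dir d = 0 -> d = 0.
Proof. by move=> /(congr1 usubmx); rewrite /dir col_mxKu linear0. Qed.

Lemma height_homog x : height (homog x) = 1.
Proof. by rewrite /height /homog col_mxKd mxE eqxx. Qed.

Lemma homog_neq0 x : homog x != 0.
Proof.
apply/eqP => /(congr1 height); rewrite height_homog /height linear0 mxE => /eqP.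
by rewrite oner_eq0.
Qed.

Lemma heightD w w' : height (w + w') = height w + height w'.
Proof. by rewrite /height linearD mxE. Qed.
Lemma heightZ (s : R) w : height (s *: w) = s * height w.
Proof. by rewrite /height linearZ mxE. Qed.
Lemma height_dir d : height (dir d) = 0.
Proof. by rewrite /height col_mxKd mxE. Qed.
Lemma usubmx_homog x : usubmx (homog x) = x.
Proof. exact: col_mxKu. Qed.
Lemma usubmx_dir x : usubmx (dir x) = x.
Proof. exact: col_mxKu. Qed.

Lemma height0P w : height w = 0 -> w = dir (usubmx w).
Proof. by move=> w0; rewrite {1}[w]vec_homog w0 scale0r add0r. Qed.

Lemma height_neq0P w : height w != 0 ->
  w = height w *: homog ((height w)^-1 *: usubmx w).
Proof.
by move=> w0; rewrite homog0_dir dirZ scalerDr scalerA mulfV// scale1r -vec_homog.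
Qed.

Lemma slice_homog al y : slice al y (homog y).
Proof. by rewrite /slice /= usubmx_homog height_homog mul1r. Qed.

Lemma sliceD al y w w' : slice al y w -> slice al y w' -> slice al y (w + w').
Proof.
by rewrite /slice /= => h h'; rewrite linearD /= bilDr h h' heightD mulrDl.
Qed.

Lemma sliceZ al y (s : R) w : slice al y w -> slice al y (s *: w).
Proof. by rewrite /slice /= => h; rewrite linearZ /= bilZr h heightZ mulrA. Qed.

(** Pulling the forms back along [U] turns statements about a slice into
    statements about R^n, where [alternative] applies. *)
Lemma slice_param al y : al != 0 -> exists U : 'M[R]_(n + 1, n),
  [/\ forall v : 'cV[R]_n, v != 0 -> U *m v != 0, forall v, slice al y (U *m v) &
      forall w, slice al y w -> exists v, w = U *m v].
Proof.
move=> al0; have d0 := dot_gt0 al0; set d := dot al al in d0.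
(* The level of [e] is one less than that of [y]: the summand [v] in the upper
   block of [U *m v] supplies the missing unit. *)
pose e := y - d^-1 *: al.
have ale : dot al e = dot al y - 1.
  by rewrite /e bilDr bilNr bilZr mulVf// gt_eqF.
pose U : 'M[R]_(n + 1, n) := col_mx (1%:M + e *m al^T) al^T.
have UE (v : 'cV[R]_n) : U *m v = col_mx (v + dot al v *: e) (dot al v)%:M.
  have av : al^T *m v = (dot al v)%:M.
    by rewrite [LHS]mx11_scalar /bil mulmx1.
  rewrite mul_col_mx av mulmxDl mul1mx -mulmxA av; congr (col_mx (_ + _) _).
  by rewrite mul_mx_scalar.
have heightU v : height (U *m v) = dot al v.
  by rewrite UE /height col_mxKd mxE eqxx.
have topU v : usubmx (U *m v) = v + dot al v *: e by rewrite UE col_mxKu.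
exists U; split.
- move=> v; apply: contra => /eqP Uv0.
  have l0 : dot al v = 0 by rewrite -heightU Uv0 /height linear0 mxE.
  by have := topU v; rewrite Uv0 linear0 l0 scale0r addr0 => <-.
- move=> v; rewrite /slice /= topU heightU bilDr bilZr ale; ring.
- move=> w ws; exists (usubmx w - height w *: e).
  have l : dot al (usubmx w - height w *: e) = height w.
    by rewrite bilDr bilNr bilZr ale ws; ring.
  rewrite UE l subrK -[LHS]vsubmxK; congr col_mx.
  by apply/matrixP => i j; rewrite !ord1 [RHS]mxE eqxx.
Qed.

Lemma bil_congr m (M : 'M[R]_(n + 1)) (U : 'M[R]_(n + 1, m)) v v' :
  bil (U^T *m M *m U) v v' = bil M (U *m v) (U *m v').
Proof. by rewrite /bil trmx_mul !mulmxA. Qed.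

Section Multipliers.
Variables (Q : 'I_3 -> 'M[R]_(n + 1)) (theta : 'I_3 -> R).
Hypothesis n3 : (3 <= n)%N.
Hypothesis Qs : forall i, (Q i)^T = Q i.
Hypothesis Qpd : forall w, w != 0 -> 0 < \sum_i theta i * bil (Q i) w w.
Variables (al : 'cV[R]_n).
Hypothesis al0 : al != 0.

Lemma slice_alternative y :
    (forall w, slice al y w -> exists i, 0 <= bil (Q i) w w) ->
  exists l : 'I_3 -> R, [/\ forall i, 0 <= l i, 0 < \sum_i l i &
    forall w, slice al y w -> 0 <= \sum_i l i * bil (Q i) w w].
Proof.
move=> h; have [U [Uinj Uin Uonto]] := slice_param y al0.
have [|||l [l0 ls lQ]] := @alternative R n (fun i => U^T *m Q i *m U) theta n3.
- by move=> i; rewrite !trmx_mul trmxK Qs mulmxA.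
- move=> v v0; under eq_bigr => i _ do rewrite bil_congr.
  exact/Qpd/Uinj.
- by move=> v; have [i iP] := h _ (Uin v); exists i; rewrite bil_congr.
exists l; split => // w /Uonto[v ->]; have := lQ v.
by under eq_bigr => i _ do rewrite bil_congr.
Qed.

Lemma slice_alternative_strict y :
    (forall w, w != 0 -> slice al y w -> exists i, 0 < bil (Q i) w w) ->
  exists l : 'I_3 -> R, [/\ forall i, 0 <= l i, 0 < \sum_i l i &
    forall w, w != 0 -> slice al y w -> 0 < \sum_i l i * bil (Q i) w w].
Proof.
move=> h; have [U [Uinj Uin Uonto]] := slice_param y al0.
have [|||l [l0 ls lQ]] := @alternative_strict R n (fun i => U^T *m Q i *m U) theta n3.
- by move=> i; rewrite !trmx_mul trmxK Qs mulmxA.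
- move=> v v0; under eq_bigr => i _ do rewrite bil_congr.
  exact/Qpd/Uinj.
- move=> v v0; have [i iP] := h _ (Uinj _ v0) (Uin v).
  by exists i; rewrite bil_congr.
exists l; split => // w w0 /Uonto[v wv]; have := lQ v.
under eq_bigr => i _ do rewrite bil_congr.
rewrite -wv; apply; apply: contra w0 => /eqP v0.
by rewrite wv v0 mulmx0.
Qed.

Variable (be : R).
Let T : set 'cV[R]_n := [set x | forall i, bil (Q i) (homog x) (homog x) <= 0].
Hypothesis Tbe : forall x, T x -> dot al x <= be.

Lemma slice_some_gt0 y w : be < dot al y -> slice al y w -> height w != 0 ->
  exists i, 0 < bil (Q i) w w.
Proof.
move=> bey ws w0; apply: contrapT => nex.
have /Tbe : T ((height w)^-1 *: usubmx w).
  move=> i; rewrite leNgt; apply/negP => Qi; apply: nex; exists i.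
  rewrite (height_neq0P w0) bilZl bilZr mulrA mulr_gt0// -expr2.
  by rewrite lt_neqAle eq_sym sqrf_eq0 w0 sqr_ge0.
by rewrite bilZr ws mulrA mulVf// mul1r leNgt bey.
Qed.

(** A point at infinity where all three forms are negative could be moved slightly
    inside the slice to a finite point of the feasible set. *)
Lemma slice_some_ge0 y w : be < dot al y -> slice al y w ->
  exists i, 0 <= bil (Q i) w w.
Proof.
move=> bey ws; have [w0|w0] := eqVneq (height w) 0; last first.
  by have [i iP] := slice_some_gt0 bey ws w0; exists i; exact: ltW.
apply: contrapT => nex.
have Qw i : bil (Q i) w w < 0.
  by rewrite ltNge; apply/negP => Qi; apply: nex; exists i.
pose h := homog y.
(* Moving [w] slightly towards [homog y], inside the slice, keeps all three forms
   negative. *)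
have small i : exists2 s0, 0 < s0 & forall s, `|s| <= s0 ->
    bil (Q i) w w + 2 * bil (Q i) w h * s + bil (Q i) h h * s ^+ 2 < 0.
  exact: quadratic_lt0_near.
have [s0 s00 h0] := small 0; have [s1 s10 h1] := small 1; have [s2 s20 h2] := small 2%:R.
pose s := Num.min s0 (Num.min s1 s2).
have s_gt0 : 0 < s by rewrite !lt_min s00 s10.
have [||i] := @slice_some_gt0 y (w + s *: h) bey.
- by apply: sliceD => //; apply/sliceZ/slice_homog.
- by rewrite heightD w0 add0r heightZ height_homog mulr1 gt_eqF.
apply/negP; rewrite -leNgt !bilE (bilC h w)//.
rewrite [leLHS](_ : _ = bil (Q i) w w + 2 * bil (Q i) w h * s + bil (Q i) h h * s ^+ 2).
  have sle0 : `|s| <= s0 by rewrite gtr0_norm// ge_min lexx.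
  have sle1 : `|s| <= s1 by rewrite gtr0_norm// !ge_min lexx orbT.
  have sle2 : `|s| <= s2 by rewrite gtr0_norm// !ge_min lexx !orbT.
  by move: i; apply: ord3P; apply/ltW; [exact: h0|exact: h1|exact: h2].
by ring.
Qed.
End Multipliers.
End Hyperplane.

(** * A multiplier that is strict at the separated point *)
Section Main.
Context (R : realType) (n : nat).

(** Since [M] is nonnegative on the slice, the slice separates the two nappes of
    the nonpositive cone of [M], each of which is convex; [be] selects one. *)
Lemma nappe_convex (M : 'M[R]_(n + 1)) (al y : 'cV[R]_n) (be : R) :
    M^T = M -> be < dot al y ->
    (forall w, slice al y w -> 0 <= bil M w w) ->
  @convex_set R 'cV[R]_n
    [set x | bil M (homog x) (homog x) <= 0 /\ dot al x <= be].
Proof.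
move=> Ms bey psd; apply/convex_setP => u v t t0 t1 [Mu au] [Mv av]; split.
  have -> : homog (t *: u + (1 - t) *: v) = t *: homog u + (1 - t) *: homog v.
    rewrite /homog !scale_col_mx add_col_mx; congr col_mx.
    by rewrite -scalerDl addrC subrK scale1r.
  pose hu := dot al y - dot al u; pose hv := dot al y - dot al v.
  have hu0 : 0 < hu by rewrite subr_gt0 (le_lt_trans au).
  have hv0 : 0 < hv by rewrite subr_gt0 (le_lt_trans av).
  (* The plane spanned by the two points meets the slice along this vector. Both
     square terms of [M] are nonpositive there, so the mixed one must compensate. *)
  have sl : slice al y (hv *: homog u - hu *: homog v).
    rewrite /slice /= linearB !linearZ /= !usubmx_homog !bilE.
    by rewrite heightD !heightZ -scaleN1r heightZ !height_homog /hu /hv; ring.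
  have := psd _ sl.
  rewrite !bilE (bilC (homog v) (homog u))//.
  set a := bil M _ _ in Mu *; set b := bil M _ _ in Mv *; set c := bil M _ _ => h.
  have c0 : c <= 0.
    have ha : hv * (hv * a) <= 0 by rewrite !mulr_ge0_le0 // ltW.
    have hb : hu * (hu * b) <= 0 by rewrite !mulr_ge0_le0 // ltW.
    rewrite -(pmulr_rle0 _ hu0) -(pmulr_rle0 _ hv0); lra.
  have s0 : 0 <= 1 - t by rewrite subr_ge0.
  have e1 : t * (t * a) <= 0 by rewrite !mulr_ge0_le0.
  have e2 : (1 - t) * ((1 - t) * b) <= 0 by rewrite !mulr_ge0_le0.
  have e3 : t * ((1 - t) * c) <= 0 by rewrite !mulr_ge0_le0.
  lra.
rewrite bilDr !bilZr.
have e1 : t * dot al u <= t * be by rewrite ler_wpM2l.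
have e2 : (1 - t) * dot al v <= (1 - t) * be by rewrite ler_wpM2l// subr_ge0.
lra.
Qed.

Section Strict.
Variables (Q : 'I_3 -> 'M[R]_(n + 1)) (theta : 'I_3 -> R).
Hypothesis n3 : (3 <= n)%N.
Hypothesis Qs : forall i, (Q i)^T = Q i.
Hypothesis Qpd : forall w, w != 0 -> 0 < \sum_i theta i * bil (Q i) w w.
Variables (al y y0 : 'cV[R]_n) (be : R).
Hypothesis Tbe : forall x,
  (forall i, bil (Q i) (homog x) (homog x) <= 0) -> dot al x <= be.
Hypothesis bey : be < dot al y.
Hypothesis y0lt : forall i, bil (Q i) (homog y0) (homog y0) < 0.

Let f i x := bil (Q i) (homog x) (homog x).
Let q i z := bil (Q i) (dir z) (dir z).

Lemma normal_neq0 : al != 0.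
Proof.
apply/eqP => al0; have : dot al y0 <= be by apply: Tbe => i; exact: ltW.
by move: bey; rewrite al0 !bil0l; lra.
Qed.

(** Here [i], [j], [k] enumerate the indices. The direction [z] lies in all the
    slices, whatever their level, so on each of them it forces weight 0 on the
    form [Q k] that is negative at [z]. *)
Lemma strict_multiplier_degenerate (z : 'cV[R]_n) (i j k : 'I_3) :
    (forall F : 'I_3 -> R, \sum_h F h = F i + F j + F k) ->
    dot al z = 0 -> q i z <= 0 -> q j z <= 0 -> q k z < 0 ->
  exists l y', [/\ forall i, 0 <= l i, be < dot al y',
    forall w, slice al y' w -> 0 <= \sum_i l i * bil (Q i) w w &
    0 < \sum_i l i * f i y].
Proof.
move=> sumE az qi qj qk; apply: contrapT => fail.
have al0 := normal_neq0.
have sumL (l : 'I_3 -> R) x : \sum_h l h * f h x = l i * f i x + l j * f j x + l k * f k x.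
  by rewrite sumE.
(* Restrict the forms to the line through [y0] and [y]; [y] is at 0 and [y0]
   at - 1. For parameters below [s0] the slice still avoids the set. *)
pose d := y - y0; pose g h (s : R) := f h (y + s *: d).
have gE h s : g h s = f h y + 2 * bil (Q h) (homog y) (dir d) * s + q h d * s ^+ 2.
  by rewrite /g /f /q homog_add_dir !bilE (bilC (dir d) (homog y))//; ring.
have gN h : f h y - 2 * bil (Q h) (homog y) (dir d) + q h d < 0.
  have := y0lt h; rewrite -/(f h y0) (_ : y0 = y + (- 1) *: d); last first.
    by rewrite scaleN1r /d opprB addrC subrK.
  by rewrite -/(g h (- 1)) gE; congr (_ < _); ring.
have y0be : dot al y0 <= be by apply: Tbe => h; exact: ltW.
pose s0 := (dot al y - be) / (dot al y - dot al y0).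
have s00 : 0 < s0 by rewrite divr_gt0 ?subr_gt0// (le_lt_trans y0be).
have mult s : `|s| < s0 -> exists l : 'I_3 -> R, [/\ forall h, 0 <= l h,
    0 < l i + l j,
    0 <= l i * g i s + l j * g j s, l i * f i y + l j * f j y <= 0 &
    0 <= l i * q i z + l j * q j z].
  move=> ss0; pose ys := y + s *: d.
  have beys : be < dot al ys.
    rewrite /ys /d bilDr bilZr bilDr bilNr.
    move: ss0; rewrite ltr_norml => /andP[+ _].
    rewrite /s0 -mulNr ltr_pdivrMr ?subr_gt0 ?(le_lt_trans y0be)// => h.
    by lra.
  have [w ws|l [l0 ls lQ]] := slice_alternative n3 Qs Qpd al0 (y := ys).
    exact: (slice_some_ge0 Qs Tbe beys ws).
  have lz : 0 <= l i * q i z + l j * q j z + l k * q k z.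
    rewrite -[leRHS](sumE (fun h => l h * q h z)); apply: lQ.
    by rewrite /slice /= usubmx_dir height_dir mul0r.
  have lk : l k = 0.
    have h1 : l i * q i z <= 0 by rewrite mulr_ge0_le0.
    have h2 : l j * q j z <= 0 by rewrite mulr_ge0_le0.
    have h3 : l k * q k z <= 0 by rewrite mulr_ge0_le0// ltW.
    have /eqP : l k * q k z = 0 by lra.
    by rewrite mulf_eq0 (lt_eqF qk) orbF => /eqP.
  exists l; split => //.
  - by have := ls; rewrite sumE lk addr0.
  - by have := lQ _ (slice_homog al ys); rewrite sumL lk mul0r addr0.
  - rewrite leNgt; apply/negP => pos; apply: fail; exists l, ys; split => //.
    by rewrite sumL lk mul0r addr0.
  - by move: lz; rewrite lk mul0r addr0.
(* If a second weight is forced to vanish, the third form alone is nonnegative on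
   the slices next to [y]. *)
have one a b : q a z < 0 -> (a = i /\ b = j \/ a = j /\ b = i) -> False.
  move=> qa ab.
  have mult' s : `|s| < s0 -> exists l : 'I_3 -> R, [/\ 0 < l b, 0 <= l b * g b s & l b * f b y <= 0].
    move=> /mult[l [l0 lij lg lf lz]]; exists l.
    have hi : l i * q i z <= 0 by rewrite mulr_ge0_le0.
    have hj : l j * q j z <= 0 by rewrite mulr_ge0_le0.
    have la : l a = 0.
      have /eqP : l a * q a z = 0 by case: ab => -[-> _]; lra.
      by rewrite mulf_eq0 (lt_eqF qa) orbF => /eqP.
    by move: la lij lg lf; case: ab => -[-> ->] ->; rewrite !mul0r ?add0r ?addr0.
  have fb : 0 < f b y.
    apply: (quadratic_gt0_of_near_ge0 s00 _ (gN b)) => s /mult'[l [lb lg _]].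
    by rewrite -gE -(pmulr_rge0 _ lb).
  have [l [lb _]] := mult' 0 ltac:(by rewrite normr0).
  by rewrite leNgt mulr_gt0.
have qi0 : q i z = 0.
  by apply/eqP; rewrite eq_le qi leNgt; apply/negP => /(one i j); apply; left.
have qj0 : q j z = 0.
  by apply/eqP; rewrite eq_le qj leNgt; apply/negP => /(one j i); apply; right.
have [|fi0 fj0] := weighted_quadratics_vanish s00 (gN i) (gN j).
  move=> s /mult[l [l0 lij lg lf lz]]; exists (l i), (l j); split => //.
  by rewrite -!gE.
(* [Q i] and [Q j] vanish at both [dir z] and [homog y], so definiteness makes
   [Q k] negative at [y] as it is at [z]: then [y] satisfies all constraints. *)
have z0 : z != 0 by apply: contraTneq qk => ->; rewrite /q /dir col_mx0 bil0l ltxx.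
have thk : 0 < theta k * q k z.
  have /Qpd : dir z != 0 by apply: contra z0 => /eqP/dir_eq0/eqP.
  by rewrite sumE -/(q i z) -/(q j z) -/(q k z) qi0 qj0 !mulr0 !add0r.
have thf : 0 < theta k * f k y.
  have := Qpd (homog_neq0 y).
  by rewrite sumE -/(f i y) -/(f j y) -/(f k y) fi0 fj0 !mulr0 !add0r.
have fk : f k y <= 0.
  rewrite leNgt; apply/negP => fk; move: thk thf.
  by rewrite nmulr_lgt0// pmulr_lgt0// => /ltW; rewrite leNgt => /negPf ->.
have : dot al y <= be.
  apply: Tbe => h; rewrite -/(f h y).
  have [] : [\/ h = i, h = j | h = k].
    apply: contrapT => nh; have := sumE (fun h' => (h' == h)%:R).
    rewrite (bigD1 h)//= eqxx big1 => [|h' /negPf -> //].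
    case: eqP => [e|_]; first by case: nh; rewrite e; constructor 1.
    case: eqP => [e|_]; first by case: nh; rewrite e; constructor 2.
    case: eqP => [e|_]; first by case: nh; rewrite e; constructor 3.
    by rewrite !addr0 => /eqP; rewrite oner_eq0.
  - by move=> ->; rewrite fi0.
  - by move=> ->; rewrite fj0.
  - by move=> ->.
by rewrite leNgt bey.
Qed.

(** Compactness settles the case where no direction of the level sets lies in the
    nonpositive cones of all three forms; otherwise definiteness yields a form
    that is negative in such a direction. *)
Lemma strict_multiplier : exists l y', [/\ forall i, 0 <= l i, be < dot al y',
    forall w, slice al y' w -> 0 <= \sum_i l i * bil (Q i) w w &
    0 < \sum_i l i * f i y].
Proof.
have al0 := normal_neq0.
have [[z [z0 az qz]]|nz] := pselect (exists z, [/\ z != 0, dot al z = 0 &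
    forall i, q i z <= 0]).
  have dz0 : dir z != 0 by apply: contra z0 => /eqP/dir_eq0/eqP.
  have [k qk] : exists k, q k z < 0.
    apply: contrapT => nk; have := Qpd dz0; rewrite big1 ?ltxx// => i _.
    have -> : bil (Q i) (dir z) (dir z) = 0; last by rewrite mulr0.
    apply/eqP; rewrite eq_le -/(q i z) qz leNgt; apply/negP => qi.
    by apply: nk; exists i.
  move: k qk; apply: ord3P => qk.
  - by apply: (@strict_multiplier_degenerate z 1 2%:R 0) => // F; rewrite sum3E; ring.
  - by apply: (@strict_multiplier_degenerate z 0 2%:R 1) => // F; rewrite sum3E; ring.
  - by apply: (@strict_multiplier_degenerate z 0 1 2%:R) => // F; rewrite sum3E; ring.
have [|l [l0 ls lQ]] := slice_alternative_strict n3 Qs Qpd al0 (y := y).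
  move=> w w0 ws; have [lw|lw] := eqVneq (height w) 0; last first.
    exact: (slice_some_gt0 Tbe bey ws lw).
  apply: contrapT => nex; apply: nz; exists (usubmx w).
  have wE := height0P lw; split.
  - by apply: contra w0 => /eqP w0; rewrite wE w0 /dir col_mx0.
  - by rewrite ws lw mul0r.
  - move=> i; rewrite /q -wE leNgt; apply/negP => Qi; apply: nex.
    by exists i.
exists l, y; split => //.
  move=> w ws; have [->|w0] := eqVneq w 0; last exact: ltW (lQ w w0 ws).
  by rewrite big1// => i _; rewrite bil0l mulr0.
by apply: lQ; [exact: homog_neq0|exact: slice_homog].
Qed.
End Strict.
End Main.

(** * Conclusion *)
Section Final.
Context (R : realType) (n : nat).
Implicit Types (M : 'M[R]_(n + 1)) (x y v : 'cV[R]_n).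

Lemma homog_continuous : continuous (@homog R n).
Proof. exact: col_mx_continuousl. Qed.

Lemma quad_continuous M : continuous (fun x => bil M (homog x) (homog x)).
Proof.
move=> x; apply: (@continuous_comp _ _ _ (@homog R n) (fun w => bil M w w)).
  exact: homog_continuous.
exact: bil_continuous.
Qed.

(** On each line through [x0] the quadratic vanishes near [x0], so its three
    coefficients vanish; these determine the form. *)
Lemma quad_zero_on_open M (O : set 'cV[R]_n) x0 : M^T = M -> open O -> O x0 ->
  (forall x, O x -> bil M (homog x) (homog x) = 0) -> M = 0.
Proof.
move=> Ms Oop Ox0 M0; set h := homog x0.
have line v : bil M h (dir v) = 0 /\ bil M (dir v) (dir v) = 0.
  have : nbhs (0 : R) [set s | O (x0 + s *: v)].
    have cont : {for (0 : R), continuous (fun s : R => x0 + s *: v)}.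
      apply: continuousD; first exact: cst_continuous.
      exact: scalel_continuous.
    by apply: cont; rewrite scale0r addr0; exact: open_nbhs_nbhs.
  move=> /nbhs_ballP[e /= e0 eO].
  have z s : `|s| < e -> bil M h h + 2 * bil M h (dir v) * s + bil M (dir v) (dir v) * s ^+ 2 = 0.
    move=> se; rewrite -(M0 (x0 + s *: v)); last first.
      by apply: eO; rewrite /ball /= sub0r normrN.
    by rewrite homog_add_dir !bilE (bilC (dir v) h)//; ring.
  have z0 := z 0; have z1 := z (e / 2); have z2 := z (- (e / 2)).
  rewrite normr0 in z0; rewrite normrN in z2; rewrite gtr0_norm ?divr_gt0// in z1 z2.
  have e2 : e / 2 < e by lra.
  move/(_ e0): z0; move/(_ e2): z1; move/(_ e2): z2; set p := e / 2.
  have p0 : 0 < p by rewrite divr_gt0.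
  rewrite expr0n !mulr0 !addr0 => h2 h1 h0.
  have hb : p * bil M h (dir v) = 0 by lra.
  have hc : p ^+ 2 * bil M (dir v) (dir v) = 0 by lra.
  split; apply/eqP.
    by move/eqP: hb; rewrite mulf_eq0 (gt_eqF p0).
  by move/eqP: hc; rewrite mulf_eq0 sqrf_eq0 (gt_eqF p0).
have hh : bil M h h = 0 by exact: M0.
have all0 w : bil M w w = 0.
  have -> : w = height w *: h + dir (usubmx w - height w *: x0).
    rewrite {1}[w]vec_homog /h (homog0_dir x0) scalerDr -addrA; congr (_ + _).
    by rewrite -dirZ /dir add_col_mx addr0 addrC subrK.
  have [l1 l2] := line (usubmx w - height w *: x0).
  by rewrite !bilE (bilC (dir _) h)// hh l1 l2; ring.
apply/matrixP => i j; rewrite mxE.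
have -> : M i j = bil M (delta_mx i 0) (delta_mx j 0).
  by rewrite /bil trmx_delta -rowE -colE !mxE.
have := all0 (delta_mx i 0 + delta_mx j 0).
by rewrite !bilE !all0 (bilC (delta_mx j 0) (delta_mx i 0))//; lra.
Qed.

Lemma quad_neg_in_open M (O : set 'cV[R]_n) : M^T = M -> M != 0 ->
  open O -> O !=set0 -> (forall x, O x -> bil M (homog x) (homog x) <= 0) ->
  exists O', [/\ open O', O' !=set0, O' `<=` O &
    forall x, O' x -> bil M (homog x) (homog x) < 0].
Proof.
move=> Ms Mn0 Oop [x0 Ox0] Mle.
exists (O `&` [set x | bil M (homog x) (homog x) < 0]); split.
- apply: openI => //; apply: (open_comp (D := [set r : R | r < 0])) => [x _|].
    exact: quad_continuous.
  exact: open_lt.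
- apply: contrapT => ne; move/eqP: Mn0; apply; apply: (quad_zero_on_open Ms Oop Ox0).
  move=> x Ox; apply/eqP; rewrite eq_le Mle// leNgt; apply/negP => xneg.
  by apply: ne; exists x.
- by move=> x [].
- by move=> x [].
Qed.

Lemma quadmx_sym (A : 'M[R]_n) b c : A^T = A -> (quadmx A b c)^T = quadmx A b c.
Proof. by move=> As; rewrite /quadmx tr_block_mx As trmxK tr_scalar_mx. Qed.

Lemma bil_quadmx_dir (A : 'M[R]_n) b c x : bil (quadmx A b c) (dir x) (dir x) = bil A x x.
Proof.
rewrite /bil /quadmx /dir tr_col_mx mul_row_block mul_row_col.
by rewrite trmx0 mulmx0 !mul0mx !addr0.
Qed.

Lemma bil_quadmx_height w : bil (quadmx 0 0 1 : 'M[R]_(n + 1)) w w = height w ^+ 2.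
Proof.
rewrite /bil /quadmx /height -{1 2}[w]vsubmxK tr_col_mx mul_row_block mul_row_col.
rewrite trmx0 !mulmx0 !add0r mul0mx add0r mulmx1 mxE big_ord_recl big_ord0 addr0.
by rewrite mxE expr2.
Qed.

End Final.

Theorem theorem3 (R : realType) (n : nat) (hn : (3 <= n)%N)
    (A : 'I_3 -> 'M[R]_n) (b : 'I_3 -> 'cV[R]_n) (c : 'I_3 -> R)
    (hA : forall i, (A i)^T = A i)
    (hT0 : quad_set A b c !=set0)
    (hpd : exists theta : 'cV[R]_3, posdefmx (aggmx A b c theta))
    (hconv : convex_hull (quad_set A b c) <> setT)
    (hint : quad_set A b c `<=` closure (interior (quad_set A b c))) :
  closure (convex_hull (quad_set A b c)) =
  \bigcap_(lambda in good_agg A b c) agg_set A b c lambda.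
Proof.
apply/seteqP; split.
  move=> x clx lam [_ hull _].
  have cl : closed (agg_set A b c lam).
    apply: (preimage_closed (D := [set r : R | r <= 0])) => [z _|].
      exact: quad_continuous.
    exact: closed_le.
  by apply: cl; apply: closure_subset clx.
move=> y yall; apply: contrapT => ycl.
set T := quad_set A b c in hT0 hint yall ycl *.
have [al [be [hal bey]]] := strict_separation (@convex_hull_convex R _ T)
   (subset_nonempty (@sub_convex_hull R _ T) hT0) ycl.
have {hpd}[theta hpd] := hpd.
pose Q i := quadmx (A i) (b i) (c i).
have Qs i : (Q i)^T = Q i by exact: quadmx_sym.
have Qpd w : w != 0 -> 0 < \sum_i theta i 0 * bil (Q i) w w.
  by move=> /hpd; rewrite -/(bil _ w w) bil_sum.
(* A zero form never takes a negative value. Replace it by the negated square of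
   the last coordinate: the constraint becomes [- 1 <= 0], which changes neither
   the feasible set nor the definite combination, and the aggregated form can
   only decrease. *)
pose Z : 'M[R]_(n + 1) := quadmx 0 0 1.
pose Q' i := if Q i == 0 then - Z else Q i.
have ZE w : bil (- Z) w w = - height w ^+ 2.
  by rewrite -scaleN1r bilZm bil_quadmx_height mulN1r.
have Q's i : (Q' i)^T = Q' i.
  by rewrite /Q'; case: ifP => // _; rewrite linearN /= quadmx_sym ?trmx0.
have [y0 y0lt] : exists y0, forall i, bil (Q' i) (homog y0) (homog y0) < 0.
  have Q'n0 i : Q' i != 0.
    rewrite /Q'; case: ifPn => // _; apply/eqP => Z0.
    have := ZE (homog 0); rewrite Z0 height_homog expr1n /bil mulmx0 mul0mx mxE; lra.
  have Q'le i x : T x -> bil (Q' i) (homog x) (homog x) <= 0.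
    move=> Tx; rewrite /Q'; case: ifP => _; last exact: Tx.
    by rewrite ZE oppr_le0 sqr_ge0.
  have O0 : T° !=set0.
    have [x0 /hint/(_ setT)[|x []]] := hT0; first exact: filterT.
    by exists x.
  have shrink i O := @quad_neg_in_open R n (Q' i) O (Q's i) (Q'n0 i).
  have [|O1 [op1 ne1 s1 neg1]] := shrink 0 _ (@open_interior _ T) O0.
    by move=> x /interior_subset; exact: Q'le.
  have [|O2 [op2 ne2 s2 neg2]] := shrink 1 _ op1 ne1.
    by move=> x /s1/interior_subset; exact: Q'le.
  have [|O3 [op3 [x Ox] s3 neg3]] := shrink 2%:R _ op2 ne2.
    by move=> x /s2/s1/interior_subset; exact: Q'le.
  by exists x; apply: ord3P; [exact/neg1/s2/s3|exact/neg2/s3|exact: neg3].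
pose theta' i := if Q i == 0 then 0 else theta i 0.
have Q'pd w : w != 0 -> 0 < \sum_i theta' i * bil (Q' i) w w.
  move=> /Qpd; congr (_ < _); apply: eq_bigr => i _.
  rewrite /theta' /Q'; case: eqP => [->|//].
  by rewrite mul0r /bil mulmx0 mul0mx mxE mulr0.
have Q'be x : (forall i, bil (Q' i) (homog x) (homog x) <= 0) -> dot al x <= be.
  move=> h; apply: hal; apply: sub_convex_hull => i.
  have := h i; rewrite /Q'; case: eqP => // Qi0 _.
  by rewrite /quad_le0 /= -/(Q i) Qi0 mulmx0 mul0mx mxE.
have [l [y' [l0 bey' lQ' ly']]] := strict_multiplier hn Q's Q'pd Q'be bey y0lt.
have leQ w i : bil (Q' i) w w <= bil (Q i) w w.
  rewrite /Q'; case: eqP => // ->; rewrite ZE /bil mulmx0 mul0mx mxE.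
  by rewrite oppr_le0 sqr_ge0.
have leS w : \sum_i l i * bil (Q' i) w w <= \sum_i l i * bil (Q i) w w.
  by apply: ler_sum => i _; rewrite ler_wpM2l.
pose lam : 'cV[R]_3 := \col_i l i.
have lamE w : bil (aggmx A b c lam) w w = \sum_i l i * bil (Q i) w w.
  by rewrite bil_sum; apply: eq_bigr => i _; rewrite mxE.
have lampsd w : slice al y' w -> 0 <= bil (aggmx A b c lam) w w.
  by move=> /lQ'/le_trans; apply; rewrite lamE.
have : agg_set A b c lam y.
  apply: yall; split.
  - by move=> i; rewrite mxE.
  - have ams : (aggmx A b c lam)^T = aggmx A b c lam.
      exact: trmx_comb.
    move=> x xT; have [] := convex_hull_sub (nappe_convex ams bey' lampsd) _ xT => //.
    move=> z Tz; split; last by apply: hal; exact: sub_convex_hull.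
    by rewrite lamE sumr_le0// => i _; rewrite mulr_ge0_le0//; exact: Tz.
  - apply: (@num_neg_eigenvalues_le1 R n _ al).
      exact: trmx_comb.
    move=> x ax; rewrite bil_sum.
    have /lampsd : slice al y' (dir x).
      by rewrite /slice /= usubmx_dir height_dir mul0r.
    rewrite lamE; congr (_ <= _); apply: eq_bigr => i _.
    by rewrite mxE bil_quadmx_dir.
apply/negP; rewrite -ltNge -/(bil _ _ _) lamE.
exact: lt_le_trans (leS _).
Qed.
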